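(* Fix integers $n,k\ge 1$ and an objective $\sum_{i=1}^n \left(\gamma_v v_i x_i+\gamma_p p_i\right)$ with real coefficients $\gamma_v$ and $\gamma_p\neq 0$. For every valuation profile $\mathbf v=(v_1,\dots,v_n)\in[0,\infty)^n$, $$\mathcal G(\mathbf v)\;=\;\sup_{F}\ \mathrm{Opt}_F(\mathbf v)\;=\;\sup_{p\ge q}\ \mathrm{Lot}_{p,q}(\mathbf v),$$ where the first supremum is over all continuous valuation distributions $F$, $\mathrm{Opt}_F(\mathbf v)$ is the objective value on $\mathbf v$ of the symmetric Bayesian optimal $k$-unit mechanism for $F$, and the second supremum is over all two-level lotteries with $0\le q\le p\le\infty$.
   Context: There are $k$ identical units and $n$ unit-demand agents with values $\mathbf v\in[0,\infty)^n$. A (randomized) mechanism has allocation probabilities $x_i(\mathbf v)\in[0,1]$ with $\sum_i x_i(\mathbf v)\le k$ and expected payments $p_i(\mathbf v)\ge 0$. For all mechanisms below, $x_i(v_i,\mathbf v_{-i})$ is non-decreasing in $v_i$ and payments are $p_i(\mathbf v)=v_i x_i(\mathbf v)-\int_0^{v_i}x_i(z,\mathbf v_{-i})\,dz$. The performance of a mechanism $M$ on $\mathbf v$, written $M(\mathbf v)$, is the expected value (over the mechanism's randomization) of $\sum_i(\gamma_v v_i x_i+\gamma_p p_i)$. Bayesian optimal mechanism $\mathrm{Opt}_F$. Let $F$ be a continuous distribution with density $f$ on the nonnegative reals. The virtual value function is $\vartheta(v)=(\gamma_v+\gamma_p)v-\gamma_p\frac{1-F(v)}{f(v)}$. Ironing: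 let $h(q)=\vartheta(F^{-1}(q))$ for $q\in[0,1]$, $H(q)=\int_0^q h(r)\,dr$, let $\check H$ be the largest convex function on $[0,1]$ bounded above by $H$, let $g$ be the derivative of $\check H$ (extended by right-continuity), and let $\bar\vartheta(z)=g(F(z))$, which is non-decreasing. $\mathrm{Opt}_F$ allocates the $k$ units to the (at most $k$) agents with the highest non-negative ironed virtual values $\bar\vartheta(v_i)$, breaking ties uniformly at random and discarding leftover units. Benchmark. $\mathcal G(\mathbf v):=\sup_F \mathrm{Opt}_F(\mathbf v)$. Two-level lottery. $\mathrm{Lot}_{p,q}$ first serves agents with values strictly more than $p$, then serves agents with values strictly more than $q$, while supplies last (choosing uniformly at random among agents of the same level when there are not enough units). Agents with value at most $q$ are rejected. *)

(* Defs.v *)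
From HB Require Import structures.
From mathcomp Require Import all_boot all_order all_algebra.
From mathcomp Require Import all_classical all_reals all_analysis.

Set Implicit Arguments.
Unset Strict Implicit.
Unset Printing Implicit Defensive.

Import Order.TTheory GRing.Theory Num.Theory.
Import numFieldNormedType.Exports.

Local Open Scope classical_set_scope.
Local Open Scope ring_scope.

Section Mechanisms.
Context {R : realType} {n : nat}.

(* A mechanism is given by its allocation rule v |-> (i |-> x_i(v)), where
   x_i(v) is a probability over the randomization of the mechanism; expected
   payments are determined by the payment identity. *)
Definition allocation := ('I_n -> R) -> 'I_n -> R.

Definition payment (x : allocation) (v : 'I_n -> R) (i : 'I_n) : R :=
  v i * x v i
  - \int[lebesgue_measure]_(z in `[0, v i]) x [eta v with i |-> z] i.

Definition performance (gv gp : R) (x : allocation) (v : 'I_n -> R) : R :=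
  \sum_(i < n) (gv * (v i * x v i) + gp * payment x v i).

(* Probability that i is served when m units are handed out to the agents of A:
   the set of served agents is uniform among the subsets of A of cardinality
   m, or is A itself when m exceeds the cardinality of A. *)
Definition uniform_serve (A : {set 'I_n}) (m : nat) (i : 'I_n) : R :=
  let outcomes := [set S : {set 'I_n} |
                    (S \subset A) && (#|S| == minn m #|A|)]%SET in
  #|[set S in outcomes | i \in S]%SET|%:R / #|outcomes|%:R.

Definition two_level_lottery (k : nat) (p q : \bar R) : allocation :=
  fun v i =>
    let high := [set j | (p < (v j)%:E)%E]%SET in
    let low := [set j | (q < (v j)%:E <= p)%E]%SET in
    if i \in high then uniform_serve high k i
    else if i \in low then uniform_serve low (k - #|high|) i
    else 0.

(* Serves agents by decreasing non-negative score w (v j), with uniform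
   tie-breaking among the agents of equal score. *)
Definition highest_score (k : nat) (w : R -> \bar R) : allocation :=
  fun v i =>
    let above := [set j | (w (v i) < w (v j))%E]%SET in
    let tied := [set j | w (v j) == w (v i)]%SET in
    if (0 <= w (v i))%E then uniform_serve tied (k - #|above|) i else 0.

End Mechanisms.

Section BayesianOptimal.
Context {R : realType}.
Variables (gv gp : R) (f : R -> R).
Let mu := @lebesgue_measure R.

(* A continuous distribution on the nonnegative reals is represented by its
   density; the values of f on the negative reals are irrelevant. *)
Definition valuation_density : Prop :=
  [/\ measurable_fun (`[0, +oo[ : set R) f,
      forall x, 0 <= x -> 0 <= f x &
      (\int[mu]_(x in `[0%R, +oo[) (f x)%:E = 1)%E].

Definition dist (x : R) : R := \int[mu]_(t in `[0, x]) f t.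

(* Generalized inverse of dist (its inverse when the density is positive). *)
Definition quantile (q : R) : R := inf [set x | 0 <= x /\ q <= dist x].

(* Where f vanishes, a set of probability zero, the quotient is 0 by the
   convention on inverses; quantile_virtual is affected on a null set only. *)
Definition virtual_value (x : R) : R :=
  (gv + gp) * x - gp * ((1 - dist x) / f x).

Definition quantile_virtual (q : R) : R := virtual_value (quantile q).

Definition cumulative_virtual (q : R) : \bar R :=
  (\int[mu]_(r in `[0%R, q]) (quantile_virtual r)%:E)%E.

Definition convex_minorant (phi : R -> R) : Prop :=
  @convex_function R R^o `[0, 1] phi /\
  forall q, 0 <= q <= 1 -> ((phi q)%:E <= cumulative_virtual q)%E.

(* The pointwise supremum of the convex minorants is the largest of them; the
   condition [ironable] below ensures that there is at least one. *)
Definition ironed_cumulative (q : R) : R :=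
  sup [set phi q | phi in convex_minorant].

(* The derivative of ironed_cumulative, where it exists, extended to [0, 1[ by
   its right limit and to 1 by its left limit. The limit may be -oo at 0. *)
Definition ironed_slope (q : R) : \bar R :=
  let D := [set r | derivable ironed_cumulative r 1] in
  let slope := fun r : R => (derive1 ironed_cumulative r)%:E in
  if q < 1 then lim (slope r @[r --> within D q^'+])
  else lim (slope r @[r --> within D q^'-]).

Definition ironed_virtual_value (x : R) : \bar R := ironed_slope (dist x).

(* The distributions for which the construction above makes sense (for instance
   all those of finite mean). If cumulative_virtual 1 = -oo, there is no convex
   minorant; by the conventions on \bar R, this includes the case in which the
   integral is undefined, being of the form +oo - oo. If cumulative_virtual 1 is
   +oo, the convex minorants are just unconstrained at 1, and ironed_slope
   does not depend on the value of ironed_cumulative at 1. *)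
Definition ironable : Prop :=
  (forall q, 0 <= q < 1 -> cumulative_virtual q \is a fin_num) /\
  (-oo < cumulative_virtual 1)%E.

Definition opt_mechanism {n : nat} (k : nat) : @allocation R n :=
  highest_score k ironed_virtual_value.

End BayesianOptimal.

Definition benchmark {R : realType} {n : nat} (gv gp : R) (k : nat)
    (v : 'I_n -> R) : \bar R :=
  ereal_sup [set (performance gv gp (opt_mechanism gv gp f k) v)%:E
            | f in [set f | valuation_density f /\ ironable gv gp f]].

(* Main.v *)
Require Import Defs.
From mathcomp Require Import all_boot all_order all_algebra.
From mathcomp Require Import all_classical all_reals all_analysis.
From mathcomp Require Import measurable_realfun.
From mathcomp Require Import zify ring lra.
Import Order.TTheory GRing.Theory Num.Theory.
Import numFieldNormedType.Exports.
Local Open Scope classical_set_scope.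
Local Open Scope ring_scope.

(* Upper bound. Ironed virtual values are non-decreasing, so on a fixed profile v
   (and on the profiles entering the payments, where one value is lowered) Opt_F
   only depends on which values score above, at, or below the (k+1)-st highest
   score s: it is the lottery with levels {score > s} and {score >= s}. These are
   up-sets, approximated by (p, oo) and (q, oo) with strict inequalities, since
   payments are integrals. The exception is an up-set containing 0, where agents
   of value 0 compete for units; admitting them is never better than the best of
   excluding them, rejecting the whole lower level, and rejecting everybody.

   Lower bound. For a continuous non-decreasing phi such that
   m(x) = ((gv + gp) x - phi(x)) / gp is positive and O(1 + x), the distribution
   of hazard rate 1/m has virtual value phi, which needs no ironing. Choosing phi
   close to a step function with jumps at q and p realizes Lot_{p,q} up to an
   arbitrarily small error. If gp < 0 <= gv then phi must be positive; the units
   left over then go, at price 0, to the agents of value at most q, which does not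
   decrease the objective. In the remaining cases gv < 0 and either gp < 0 or
   gv + gp <= 0: the objective is at most 0 for every lottery, and a uniform
   distribution has negative ironed virtual values, so that Opt_F rejects
   everybody. *)

Set Implicit Arguments.
Unset Strict Implicit.
Unset Printing Implicit Defensive.

(** * Lotteries *)

Section UniformServe.
Context {R : realType} {n : nat}.
Implicit Types (A : {set 'I_n}) (i : 'I_n).

(** The chance of each of [a] equally ranked agents when [m] units are left. It is 0 for [a = 0], by
    the convention on division. *)
Definition share (m a : nat) : R := (minn m a)%:R / a%:R.

(** Double counting: the [r]-subsets of [A] containing [i] are all [r]-subsets except those of
    [A :\ i], so Pascal's rule counts them, and r C(a, r) = a C(a - 1, r - 1) turns the count into
    the ratio r / a. *)
Lemma uniform_serveE A m i : i \in A -> uniform_serve A m i = share m #|A|.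
Proof.
move=> iA; rewrite /uniform_serve /share.
set r := minn m #|A|.
set O := [set S : {set 'I_n} | (S \subset A) && (#|S| == r)]%SET.
have cardO : #|O| = 'C(#|A|, r) by rewrite cards_draws.
have cardA : #|A| = #|A :\ i|.+1 by rewrite (cardsD1 i A) iA.
have cardNi : #|O :\: [set S : {set 'I_n} | i \in S]%SET| = 'C(#|A :\ i|, r).
  rewrite -cards_draws; apply: eq_card => S.
  by rewrite !inE subsetD1; case: (i \in S); rewrite ?andbT ?andbF.
have cardi : (#|[set S in O | i \in S]%SET| + 'C(#|A :\ i|, r) = 'C(#|A|, r))%N.
  rewrite -cardNi -cardO -(cardsID [set S : {set 'I_n} | i \in S]%SET O); congr (_ + _)%N.
  by apply: eq_card => S; rewrite !inE.
rewrite cardO.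
have rA : (r <= #|A|)%N by exact: geq_minr.
have Cgt0 : (0 < 'C(#|A|, r))%N by rewrite bin_gt0.
suff Ni : (#|[set S in O | i \in S]%SET| * #|A| = r * 'C(#|A|, r))%N.
  have A0 : #|A|%:R != 0 :> R by rewrite pnatr_eq0 cardA.
  have C0 : 'C(#|A|, r)%:R != 0 :> R by rewrite pnatr_eq0 -lt0n.
  by apply/eqP; rewrite eqr_div // -!natrM Ni.
move: #|[set S in O | i \in S]%SET| cardi => N.
clear cardNi Cgt0 cardO O; clearbody r; case: r rA => [|r'] rA.
  by rewrite !bin0 -[RHS]add0n => /addIn ->.
rewrite cardA binS addnC => /addnI ->.
by rewrite -binS mulnC mul_bin_diag.
Qed.

Lemma share_ge0 m a : 0 <= share m a.
Proof. by rewrite divr_ge0. Qed.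

Lemma share_full m a : (0 < a <= m)%N -> share m a = 1.
Proof.
by case/andP => a0 am; rewrite /share (minn_idPr am) divff // pnatr_eq0 -lt0n.
Qed.

Lemma share0 a : share 0 a = 0.
Proof. by rewrite /share min0n mul0r. Qed.

Lemma share_le1 m a : share m a <= 1.
Proof.
have [->|a0] := posnP a; first by rewrite /share minn0 mul0r.
by rewrite ler_pdivrMr ?ltr0n // mul1r ler_nat geq_minr.
Qed.

Lemma share_decr m a b : (0 < a <= b)%N -> share m b <= share m a.
Proof.
case/andP => a0 ab; have b0 := leq_trans a0 ab.
rewrite /share ler_pdivrMr ?ltr0n // mulrAC ler_pdivlMr ?ltr0n //.
rewrite -!natrM ler_nat; rewrite !minnE; nia.
Qed.

(** Adding one unit and one competitor to both pools raises the ratio [share m b / share m a]; the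
    inequality is cross-multiplied because the shares may vanish. An upper agent who moves down to
    the lower level causes exactly this change: it frees a unit and joins the pool. *)
Lemma share_ratio m a b : (0 < a <= b)%N ->
  share m b * share m.+1 a.+1 <= share m.+1 b.+1 * share m a.
Proof.
case/andP => a0 ab; have b0 := leq_trans a0 ab.
have [bm|mb] := leqP b m.
  by rewrite !share_full ?ltnS ?b0 ?a0 ?(leq_trans ab).
have [am|ma] := leqP a m.
  rewrite !(share_full (m:=m) (a:=a), share_full (m:=m.+1)(a:=a.+1)) ?a0 // !mulr1.
  rewrite /share !(minn_idPl _) 1?ltnW //.
  rewrite ler_pdivrMr ?ltr0n // mulrAC ler_pdivlMr ?ltr0n //.
  by rewrite -!natrM ler_nat; nia.
rewrite /share !(minn_idPl _) ?ltnS 1?ltnW // !mulf_div.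
rewrite ler_pdivrMr ?mulr_gt0 ?ltr0n // mulrAC ler_pdivlMr ?mulr_gt0 ?ltr0n //.
by rewrite -!natrM ler_nat; nia.
Qed.

End UniformServe.

(** * Integrability of monotone allocations and comparison of payments *)

Section IntegrableMonotone.
Context {R : realType}.
Local Notation mu := (@lebesgue_measure R).

Lemma nondecreasing_integrable (g : R -> R) (a : R) : 0 <= a ->
  (forall z z', 0 <= z -> z <= z' -> z' <= a -> g z <= g z') ->
  mu.-integrable `[0, a] (EFin \o g).
Proof.
move=> a0 mon.
(* Clamping the argument to [0, a] makes [g] monotone on the whole line, hence measurable; the
   values at the endpoints bound it. *)
pose c (z : R) : R := Num.min (Num.max z 0) a.
have c_itv (z : R) : 0 <= c z <= a.
  by rewrite /c ge_min lexx orbT andbT le_min a0 le_max lexx orbT.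
have cE (z : R) : 0 <= z <= a -> c z = z.
  by case/andP => z0 za; rewrite /c max_l // min_l.
have gcmon : {homo (g \o c) : z z' / z <= z'}.
  move=> z z' zz'; have /andP[c0 _] := c_itv z; have /andP[_ ca] := c_itv z'.
  by apply: mon => //; rewrite /c le_min2 // le_max2.
apply: measurable_bounded_integrable => //.
- exact/compact_finite_measure/segment_compact.
- apply: (@eq_measurable_fun _ _ _ _ _ (g \o c)).
    by move=> z; rewrite inE /= in_itv /= => za; rewrite cE.
  exact: nondecreasing_measurable.
- exists (`|g 0| + `|g a|); split; first exact: num_real.
  move=> M ltM z /= za; apply: le_trans (ltW ltM).
  have /andP[g1 g2] : g 0 <= g z <= g a.
    by move: za; rewrite in_itv /= => /andP[z0 za]; rewrite !mon.
  rewrite ler_norml; apply/andP; split.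
    have := ler_norm (- g 0); rewrite normrN; have := normr_ge0 (g a); lra.
  have := ler_norm (g a); have := normr_ge0 (g 0); lra.
Qed.

End IntegrableMonotone.

Section Sections.
Context {R : realType} {n : nat}.
Implicit Types (x y : @allocation R n) (v : 'I_n -> R) (i : 'I_n).
Local Notation mu := (@lebesgue_measure R).

Lemma update_id v i : ([eta v with i |-> v i] : 'I_n -> R) = v.
Proof. by apply/funext => j /=; case: eqP => [->|]. Qed.

(** Restricted to values up to [v i], the range over which the payment at [v] integrates. *)
Definition monotone_at x v i := forall z z', 0 <= z -> z <= z' -> z' <= v i ->
  x [eta v with i |-> z] i <= x [eta v with i |-> z'] i.

Lemma monotone_integrable x v i : 0 <= v i -> monotone_at x v i ->
  mu.-integrable `[0, v i] (EFin \o (fun z => x [eta v with i |-> z] i)).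
Proof. by move=> v0 mon; exact: nondecreasing_integrable. Qed.

Lemma integrable_cst_itv (a b c : R) : mu.-integrable `[a, b] (EFin \o cst c).
Proof.
apply: measurable_bounded_integrable => //.
  exact/compact_finite_measure/segment_compact.
exists `|c|; split; first exact: num_real.
by move=> M cM z _ /=; exact: ltW.
Qed.

Lemma Rintegral_cst0a (a c : R) : 0 <= a -> \int[mu]_(z in `[0, a]) c = a * c.
Proof.
move=> a0; rewrite Rintegral_cst //= ?lebesgue_measure_itv /=.
  by rewrite lte_fin; case: ltgtP a0 => // [a0|<-] _ /=; rewrite ?subr0 ?mulr0 ?mul0r // mulrC.
Qed.

Lemma lebesgue_measure_oc_le (a t : R) : 0 <= t -> (mu `]a, (a + t)%R] <= t%:E)%E.
Proof.
move=> t0; rewrite lebesgue_measure_itv /= lte_fin ltrDl lt0r t0 andbT.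
by case: eqP => [->|_] //=; rewrite -EFinD addrAC subrr add0r.
Qed.

Lemma lebesgue_measureU_le (A B : set R) (a b : \bar R) :
  measurable A -> measurable B ->
  (mu A <= a -> mu B <= b -> mu (A `|` B) <= a + b)%E.
Proof. by move=> mA mB Aa Bb; apply: le_trans (leeD Aa Bb); exact: measureU2. Qed.

(** With the constant [x v i] moved under the integral sign, payments can be compared pointwise, and
    monotonicity makes the integrand non-negative. *)
Lemma paymentE x v i : 0 <= v i -> monotone_at x v i ->
  payment x v i = \int[mu]_(z in `[0, v i]) (x v i - x [eta v with i |-> z] i).
Proof.
move=> v0 mon; rewrite /payment RintegralB ?Rintegral_cst0a //.
  exact: integrable_cst_itv.
exact: monotone_integrable.
Qed.

(** [E] is an exceptional set on which the integrands may be off by as much as 1, which costs at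
    most the measure of [E]. *)
Lemma payment_le x y v i (E : set R) (eps : R) : 0 <= v i ->
  monotone_at x v i -> monotone_at y v i -> measurable E -> (mu E <= eps%:E)%E ->
  (forall z, 0 <= z <= v i -> x v i - x [eta v with i |-> z] i <=
     y v i - y [eta v with i |-> z] i + \1_E z) ->
  payment x v i <= payment y v i + eps.
Proof.
move=> v0 mx my mE muE xy.
have indI : mu.-integrable `[0, v i] (EFin \o (\1_E : R -> R)).
  apply: measurable_bounded_integrable => //.
    exact/compact_finite_measure/segment_compact.
  exists 1; split; first exact: num_real.
  move=> M M1 z _ /=; apply: le_trans (ltW M1).
  by rewrite ger0_norm indicE ?ler0n // lern1 leq_b1.
have diffI w : monotone_at w v i ->
    mu.-integrable `[0, v i] (EFin \o (fun z => w v i - w [eta v with i |-> z] i)).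
  move=> mw; have := integrableB _ (integrable_cst_itv 0 (v i) (w v i)) (monotone_integrable v0 mw).
  exact.
rewrite !paymentE //.
apply: (le_trans (y := \int[mu]_(z in `[0, v i])
    (y v i - y [eta v with i |-> z] i + \1_E z))).
  apply: le_Rintegral => //; first exact: diffI.
  exact: (@integrableD _ _ _ mu _ (measurable_itv _) _ _ (diffI _ my) indI).
rewrite RintegralD //; [|exact: diffI..].
rewrite lerD2l /Rintegral integral_indic //.
have muEI : (mu (E `&` `[0%R, v i]) <= eps%:E)%E.
  by apply: le_trans muE; apply: le_measure; rewrite ?inE //; exact: measurableI.
have muEfin : mu (E `&` `[0, v i]) \is a fin_num.
  by rewrite ge0_fin_numE // (le_lt_trans muEI) ?ltry.
by rewrite -lee_fin fineK.
Qed.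

End Sections.

(** * Lotteries whose two levels are arbitrary up-sets *)

Section Lottery.
Context {R : realType} {n : nat}.
Implicit Types (v : 'I_n -> R) (i j : 'I_n) (z : R) (X Y : R -> bool) (k : nat).

(** Levels are predicates and not thresholds because a monotone score may cut the half-line into
    closed as well as open rays. *)
Definition lottery k X Y : @allocation R n := fun v i =>
  let high := [set j | X (v j)]%SET in
  let low := [set j | ~~ X (v j) && Y (v j)]%SET in
  if i \in high then uniform_serve high k i
  else if i \in low then uniform_serve low (k - #|high|) i
  else 0.

Lemma two_level_lotteryE k (p q : \bar R) :
  two_level_lottery k p q =
  lottery k (fun z => p < z%:E)%E (fun z => q < z%:E)%E.
Proof.
apply/funext => v; apply/funext => i; rewrite /two_level_lottery /lottery.
have -> : [set j | (q < (v j)%:E <= p)%E]%SET =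
    [set j | ~~ (p < (v j)%:E)%E && (q < (v j)%:E)%E]%SET.
  by apply/setP => j; rewrite !inE leNgt andbC.
by [].
Qed.

Definition high_others X v i := #|[set j | (j != i) && X (v j)]%SET|.

Lemma high_othersE X v i : high_others X v i = #|[set j | X (v j)]%SET :\ i|.
Proof. by apply: eq_card => j; rewrite !inE. Qed.

Definition low_others X Y v i :=
  #|[set j | [&& j != i, ~~ X (v j) & Y (v j)]]%SET|.

(** The levels of the other agents do not depend on [z], so the allocation of [i] is a step function
    of its own value; the successors count [i] itself. *)
Lemma lottery_update k X Y v i z :
  lottery k X Y [eta v with i |-> z] i =
  if X z then share k (high_others X v i).+1
  else if Y z then share (k - high_others X v i) (low_others X Y v i).+1
  else 0.
Proof.
rewrite /lottery !inE /= eqxx.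
have eq_others (P : pred R) :
    [set j | P (if j == i then z else v j)]%SET :\ i =
    [set j | (j != i) && P (v j)]%SET.
  by apply/setP => j; rewrite !inE; case: eqP.
case: ifPn => Xz.
  rewrite uniform_serveE ?inE /= ?eqxx // (cardsD1 i) !inE eqxx Xz.
  by rewrite eq_others.
rewrite (negbTE Xz) /=; case: ifPn => // Yz.
rewrite uniform_serveE ?inE /= ?eqxx ?Xz //.
rewrite [X in share (_ - X)](cardsD1 i) [X in share _ X](cardsD1 i).
rewrite !inE /= eqxx (negbTE Xz) Yz add0n add1n.
by rewrite eq_others (eq_others (fun z => ~~ X z && Y z)).
Qed.

Lemma lottery_at k X Y v i : lottery k X Y v i =
  if X (v i) then share k (high_others X v i).+1
  else if Y (v i) then share (k - high_others X v i) (low_others X Y v i).+1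
  else 0.
Proof. by rewrite -lottery_update update_id. Qed.

Lemma lottery_itv01 k X Y v i : 0 <= lottery k X Y v i <= 1.
Proof.
rewrite lottery_at; case: ifP => _; first by rewrite share_ge0 share_le1.
by case: ifP => _; rewrite ?share_ge0 ?share_le1 ?lexx ?ler01.
Qed.

(** Units reach the lower level only if [h < k], and then all [h.+1] agents of the upper level are
    served for sure. *)
Lemma share_low_le_high k h l : share (k - h) l.+1 <= share k h.+1 :> R.
Proof.
have [kh|hk] := leqP k h.
  by rewrite (eqP kh) share0 share_ge0.
by rewrite [leRHS]share_full ?share_le1.
Qed.

Definition upward X := forall z z', 0 <= z -> z <= z' -> X z -> X z'.

Lemma lottery_monotone k X Y v i : upward X -> upward Y -> monotone_at (lottery k X Y) v i.
Proof.
move=> upX upY z z' z0 zz' _; rewrite !lottery_update.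
case: ifP => [Xz|_]; first by rewrite (upX _ _ z0 zz' Xz).
case: ifP => [Yz|_].
  by rewrite (upY _ _ z0 zz' Yz); case: ifP => _; rewrite ?share_low_le_high.
by case: ifP => _; [|case: ifP => _]; rewrite ?share_ge0.
Qed.

Lemma payment_ge0 (x : @allocation R n) v i : 0 <= v i -> monotone_at x v i ->
  0 <= payment x v i.
Proof.
move=> v0 mon; rewrite paymentE //; apply: Rintegral_ge0 => z /=.
rewrite in_itv /= => /andP[z0 zv].
by rewrite subr_ge0 -{2}(update_id v i) mon.
Qed.

Lemma payment_le_value (x : @allocation R n) v i : 0 <= v i ->
  (forall z, 0 <= z <= v i -> 0 <= x [eta v with i |-> z] i) ->
  payment x v i <= v i * x v i.
Proof.
move=> v0 x0; rewrite /payment lerBlDr lerDl; apply: Rintegral_ge0 => z /=.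
by rewrite in_itv /=; exact: x0.
Qed.

(* On the profiles obtained by lowering one entry of [v], serving by decreasing
   score amounts to a lottery whose lower level consists of the agents tied with
   the [k+1]-st highest score. *)
Lemma highest_score_lottery k (w : R -> \bar R) v :
  (forall i, 0 <= v i) -> (forall x y, 0 <= x -> x <= y -> (w x <= w y)%E) ->
  exists X Y, [/\ upward X, upward Y, (forall z, X z -> Y z) &
    forall i z, 0 <= z <= v i ->
      highest_score k w [eta v with i |-> z] i =
      lottery k X Y [eta v with i |-> z] i].
Proof.
move=> v0 wmon.
pose vz i z : 'I_n -> R := [eta v with i |-> z].
have vz_le i z j : 0 <= z <= v i -> 0 <= vz i z j <= v j.
  by move=> zv; rewrite /vz /=; case: eqP => [->|] //; rewrite v0 lexx.
have vzi i z : vz i z i = z by rewrite /vz /= eqxx.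
(* When at most [k] agents of [v] satisfy the up-set [P], everybody tied with or above a member of
   [P] satisfies it too, so there are units for all of them and both rules serve [i] with
   probability 1. *)
have served (P : pred R) i z : upward P -> (#|[set j | P (v j)]%SET| <= k)%N ->
    (forall z', P z -> (w z <= w z')%E -> P z') -> 0 <= z <= v i -> P z -> (0 <= w z)%E ->
    highest_score k w (vz i z) i = 1 /\ share k (high_others P v i).+1 = 1 :> R.
  move=> upP cardP upwP zv Pz wz0.
  have Pvi : P (v i) by case/andP: zv => z0 zv; exact: upP Pz.
  split; last first.
    by rewrite share_full //= high_othersE; move: cardP; rewrite (cardsD1 i) inE Pvi.
  rewrite /highest_score vzi wz0 uniform_serveE ?inE ?vzi ?eqxx //.
  set A := [set j | w (vz i z j) == _]%SET; set B := [set j | _]%SET.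
  have Ai : i \in A by rewrite inE vzi.
  have disjAB : A :&: B = finset.set0.
    apply/setP => j; rewrite !inE.
    by apply/negbTE/negP => /andP[/eqP-> ]; rewrite ltxx.
  have ABP : (#|A :|: B| <= k)%N.
    apply: leq_trans cardP; apply: subset_leq_card; apply/fintype.subsetP => j.
    have /andP[j0 jv] := vz_le i z j zv.
    rewrite !inE => jAB; apply: upP jv _ => //; apply: upwP => //.
    by case/orP: jAB => [/eqP->//|/ltW].
  have := cardsUI A B; rewrite disjAB cards0 addn0 => cardAB.
  have A0 : (0 < #|A|)%N by rewrite (cardsD1 i) Ai.
  have {cardAB}ABk : (#|A| + #|B| <= k)%N by rewrite -cardAB.
  by apply: share_full; move: #|A| #|B| A0 ABk => a b; lia.
pose Y0 z := (0 <= w z)%E.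
have upY0 : upward Y0 by move=> z z' z0 zz'; rewrite /Y0 => /le_trans; apply; exact: wmon.
have [few|many] := leqP #|[set j | Y0 (v j)]%SET| k.
  exists Y0, Y0; split => // i z zv; rewrite lottery_update.
  case: (boolP (Y0 z)) => Yz; last first.
    by rewrite /highest_score -/(vz i z) vzi -/(Y0 z) (negbTE Yz).
  by have [] := served Y0 i z upY0 few (fun _ => @le_trans _ _ _ _ _) zv Yz Yz => -> ->.
(* The highest score among the agents of [P] is the (k+1)-st highest score of the profile: more than
   [k] agents reach it and, by maximality, at most [k] exceed it. *)
pose P j := (0 <= w (v j))%E && (k < #|[set j' | (w (v j) <= w (v j'))%E]%SET|)%N.
have lowest (Q : pred 'I_n) : (k < #|[set j | Q j]%SET|)%N ->
    exists2 j, Q j & (k < #|[set j' | (w (v j) <= w (v j'))%E]%SET|)%N.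
  move=> kQ; have : (0 < #|[set j | Q j]%SET|)%N by exact: leq_ltn_trans kQ.
  rewrite card_gt0 => /set0Pn[j0]; rewrite inE => Qj0.
  have [j Qj jmin] := @Order.TotalTheory.arg_minP _ _ _ j0 Q (fun j => w (v j)) Qj0.
  exists j => //; apply: leq_trans kQ _; apply: subset_leq_card.
  by apply/fintype.subsetP => j'; rewrite !inE; exact: jmin.
have [j0 Pj0] : exists j, P j.
  by have [j Qj kj] := lowest (fun j => Y0 (v j)) many; exists j; apply/andP.
have [jm Pm jmax] := @Order.TotalTheory.arg_maxP _ _ _ j0 P (fun j => w (v j)) Pj0.
set s := w (v jm) in jmax.
have [s0 ks] : (0 <= s)%E /\ (k < #|[set j | (s <= w (v j))%E]%SET|)%N by exact/andP.
have ks' : (#|[set j | (s < w (v j))%E]%SET| <= k)%N.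
  rewrite leqNgt; apply/negP => /lowest[j sj kj].
  have /jmax : P j by rewrite /P kj andbT (le_trans s0 (ltW sj)).
  by move=> /(lt_le_trans sj); rewrite ltxx.
pose X z := (s < w z)%E; pose Y z := (s <= w z)%E.
have upX : upward X by move=> z z' z0 zz'; rewrite /X => /lt_le_trans; apply; exact: wmon.
have upY : upward Y by move=> z z' z0 zz'; rewrite /Y => /le_trans; apply; exact: wmon.
exists X, Y; split => //; first by move=> z; exact: ltW.
move=> i z zv; rewrite lottery_update.
case: (boolP (X z)) => [Xz|]; last first.
  rewrite /X -leNgt => zs; case: (boolP (Y z)) => [Yz|]; last first.
    rewrite /Y -ltNge => zs'; rewrite /highest_score -/(vz i z) vzi.
    case: ifP => // z0; rewrite uniform_serveE ?inE ?vzi ?eqxx //.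
    (* More than [k] agents of [v] score at least [s]; at least [k] of them remain after removing
       [i], whose value was lowered to [z], and no unit is left for it. *)
    suff: (k <= #|[set j | (w z < w (vz i z j))%E]%SET|)%N.
      by rewrite -subn_eq0 => /eqP->; rewrite share0.
    rewrite -ltnS; apply: leq_trans ks _; rewrite (cardsD1 i).
    apply: (@leq_trans (1 + #|[set j | (s <= w (v j))%E]%SET :\ i|)).
      by rewrite leq_add2r leq_b1.
    rewrite add1n ltnS; apply: subset_leq_card; apply/fintype.subsetP => j.
    rewrite !inE /vz /= => /andP[/negbTE-> sj]; exact: lt_le_trans sj.
  have szE : w z = s by apply/eqP; rewrite eq_le zs.
  transitivity (lottery k X Y (vz i z) i); last first.
    by rewrite lottery_update /X /Y szE ltxx lexx.
  have Xz : X z = false by rewrite /X szE ltxx.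
  rewrite -/(vz i z) /highest_score /lottery !inE vzi Xz Yz szE s0 /=.
  congr (uniform_serve _ _ _).
  by apply/setP => j; rewrite !inE /X /Y -leNgt eq_le.
have z0 : (0 <= w z)%E by exact: le_trans (ltW Xz).
by have [] := served X i z upX ks' (fun z' sz => lt_le_trans sz) zv Xz z0 => -> ->.
Qed.

End Lottery.

(** * Comparing performances, and the upper bound for levels that exclude 0 *)

Section Compare.
Context {R : realType} {n : nat}.
Variables (gv gp : R).
Implicit Types (x y : @allocation R n) (v : 'I_n -> R) (i j : 'I_n) (X Y : R -> bool).
Local Notation mu := (@lebesgue_measure R).
Local Notation perf := (performance gv gp).

Lemma performance_ext x y v :
  (forall i z, 0 <= z <= v i -> x [eta v with i |-> z] i = y [eta v with i |-> z] i) ->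
  (forall i, 0 <= v i) -> perf x v = perf y v.
Proof.
move=> xy v0; rewrite /performance; apply: eq_bigr => i _.
have xyv : x v i = y v i by rewrite -(update_id v i) xy // v0 lexx.
rewrite /payment xyv; congr (_ + _ * (_ - _)).
by apply: eq_Rintegral => z; rewrite inE /= in_itv /=; exact: xy.
Qed.

Lemma performance_le x y v (eps : R) :
  (forall i, gv * (v i * x v i) + gp * payment x v i <=
             gv * (v i * y v i) + gp * payment y v i + eps) ->
  perf x v <= perf y v + n%:R * eps.
Proof.
move=> xy; rewrite /performance.
have -> : n%:R * eps = \sum_(i < n) eps.
  by rewrite sumr_const card_ord mulr_natl.
by rewrite -big_split /=; apply: ler_sum => i _; exact: xy.
Qed.

(** Since the rules agree on [v], only payments differ. The payment bound is applied in both
    directions, so that the sign of [gp] does not matter. *)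
Lemma performance_close x y v (E : set R) (eps : R) :
  (forall i, 0 <= v i) ->
  (forall i, monotone_at x v i) -> (forall i, monotone_at y v i) ->
  measurable E -> (mu E <= eps%:E)%E ->
  (forall i, x v i = y v i) ->
  (forall i z, 0 <= z <= v i -> 0 <= x [eta v with i |-> z] i <= 1) ->
  (forall i z, 0 <= z <= v i -> 0 <= y [eta v with i |-> z] i <= 1) ->
  (forall i z, 0 <= z <= v i -> ~ E z ->
    x [eta v with i |-> z] i = y [eta v with i |-> z] i) ->
  perf x v <= perf y v + n%:R * (`|gp| * eps).
Proof.
move=> v0 mx my mE muE xyv x01 y01 xyz.
have pay x' y' i : monotone_at x' v i -> monotone_at y' v i -> x' v i = y' v i ->
    (forall z, 0 <= z <= v i -> 0 <= x' [eta v with i |-> z] i) ->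
    (forall z, 0 <= z <= v i -> y' [eta v with i |-> z] i <= 1) ->
    (forall z, 0 <= z <= v i -> ~ E z ->
      x' [eta v with i |-> z] i = y' [eta v with i |-> z] i) ->
    payment x' v i <= payment y' v i + eps.
  move=> mx' my' e x0 y1 xy; apply: (payment_le (E := E)) => // z zv.
  rewrite e -addrA lerD2l indicE; have [Ez|Ez] := pselect (E z).
    by rewrite mem_set //=; have := x0 z zv; have := y1 z zv; lra.
  by rewrite memNset // addr0 xy.
apply: performance_le => i; rewrite xyv -addrA lerD2l -lerBlDl -mulrBr.
apply: le_trans (ler_norm _) _; rewrite normrM ler_wpM2l // ler_norml.
apply/andP; split.
  rewrite lerBrDl lerBlDr; apply: pay => //.
  - by move=> z /y01/andP[].
  - by move=> z /x01/andP[].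
  - by move=> z zv Ez; rewrite xyz.
rewrite lerBlDl; apply: pay => //; first by move=> z /x01/andP[].
  by move=> z /y01/andP[].
by move=> z; exact: xyz.
Qed.

(** For [gp <= 0] both terms are non-positive. Otherwise a payment is at most the value received,
    which leaves at most [gv + gp <= 0] times that value. *)
Lemma performance_le0 x v : (forall i, 0 <= v i) ->
  (forall i, monotone_at x v i) ->
  (forall i z, 0 <= z <= v i -> 0 <= x [eta v with i |-> z] i) ->
  gv <= 0 -> gp <= 0 \/ gv + gp <= 0 -> perf x v <= 0.
Proof.
move=> v0 mx x0 gv0 gvp; apply: sumr_le0 => i _.
have p0 := payment_ge0 (v0 i) (mx i); have px := payment_le_value (v0 i) (x0 i).
have : 0 <= v i * x v i by apply: le_trans px.
case: (lerP gp 0) => gp0; first by nra.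
case: gvp => [|g]; first lra.
move: (payment x v i) (v i * x v i) p0 px => p w p0 px w0.
have : gp * p <= gp * w by rewrite ler_wpM2l // ltW.
nra.
Qed.

Lemma performance0 x v : (forall i, 0 <= v i) ->
  (forall i z, 0 <= z <= v i -> x [eta v with i |-> z] i = 0) -> perf x v = 0.
Proof.
move=> v0 x0; rewrite (@performance_ext x (fun=> fun=> 0)) //.
rewrite /performance big1 // => i _.
by rewrite /payment Rintegral_cst0a // !mulr0 subr0 mulr0 addr0.
Qed.

(** An up-set is an open ray up to a short interval near its infimum. The lower bound [b] on the
    threshold serves to keep two thresholds ordered. *)
Lemma threshold X v (b M t : R) : upward X -> (forall i, 0 <= v i <= M) ->
  0 <= b <= M -> ~~ X b -> 0 < t ->
  exists p, [/\ b <= p <= M, ~~ X p, (forall j, X (v j) = (p < v j)) &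
    forall z, 0 <= z <= M -> ~ (p < z <= p + t) -> X z = (p < z)].
Proof.
move=> upX vM /andP[b0 bM] Xb t0.
pose S := [set z | 0 <= z <= M /\ ~~ X z].
have supS : has_sup S.
  by split; [exists b; rewrite /S /= b0 bM | exists M => z [/andP[]]].
have [y [/andP[y0 yM] Xy] yt] := sup_adherent t0 supS.
(* Above [y] and outside [X], the point [p] is within [t] of the supremum of the complement. Passing
   all the values outside [X] makes the ray agree with [X] exactly on the profile. *)
pose p := \big[Num.max/Num.max b y]_(j | ~~ X (v j)) v j.
have [pM Xp] : p <= M /\ ~~ X p.
  rewrite /p; elim/big_ind: _ => [|u w [uM Xu] [wM Xw]|j Xj].
  - by split; [rewrite ge_max bM|rewrite /Num.max; case: ifP].
  - by split; [rewrite ge_max uM|rewrite /Num.max; case: ifP].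
  - by split=> //; have /andP[] := vM j.
have /andP[bp yp] : (b <= p) && (y <= p).
  by rewrite -ge_max /p; apply/bigmax_geP; left.
have p0 : 0 <= p := le_trans b0 bp.
have NX z : 0 <= z -> z <= p -> X z = false.
  by move=> z0 zp; apply: contraNF Xp; exact: upX.
exists p; split => //; first by rewrite bp.
  move=> j; have /andP[vj0 _] := vM j.
  have [pv|vp] := ltP p (v j); last exact: NX.
  apply: contraTT pv => Xj; rewrite -leNgt.
  by apply/bigmax_geP; right; exists j.
move=> z /andP[z0 zM] zE; have [pz|zp] := ltP p z; last exact: NX.
apply: contrapT => /negP Xz; apply: zE; rewrite pz /=.
have : z <= sup S by apply: ub_le_sup => //; [case: supS|rewrite /S /= z0 zM].
by move=> zS; lra.
Qed.

Section UpperBound.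
Variables (k : nat) (v : 'I_n -> R) (S : \bar R).
Hypothesis v0 : forall i, 0 <= v i.
Hypothesis lotS : forall p q : \bar R, (0 <= q <= p)%E ->
  ((perf (two_level_lottery k p q) v)%:E <= S)%E.

Lemma lottery_le_sup X Y : upward X -> upward Y ->
  (forall z, 0 <= z -> X z -> Y z) -> ~~ Y 0 ->
  ((perf (lottery k X Y) v)%:E <= S)%E.
Proof.
move=> upX upY XY Y0.
pose M := \sum_i v i.
have vM i : 0 <= v i <= M.
  by rewrite v0 /M (bigD1 i) //= lerDl sumr_ge0.
have M0 : 0 <= M by exact: sumr_ge0.
apply/lee_addgt0Pr => e e0.
(* Two intervals of length [t] cost [n * |gp| * 2 * t] in total; the added 1 keeps [c] positive. *)
pose c : R := (n%:R * (`|gp| * 2)) + 1.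
have c0 : 0 < c by rewrite ltr_wpDl // mulr_ge0 // mulr_ge0.
pose t := e / c.
have t0 : 0 < t by rewrite divr_gt0.
have [q [/andP[q0 qM] Yq Yv Yz]] := threshold upY vM (b := 0) (M := M) (t := t)
  ltac:(by rewrite lexx) Y0 t0.
have Xq : ~~ X q by apply: contra Yq; exact: XY.
(* Starting the second search at [q], which is outside [X] because [X] implies [Y], ensures
   [q <= p]. *)
have [p [/andP[qp pM] Xp Xv Xz]] := threshold upX vM (b := q) (M := M) (t := t)
  ltac:(by rewrite q0) Xq t0.
have lotpq : ((0 : \bar R) <= q%:E <= p%:E)%E by rewrite !lee_fin q0.
apply: le_trans (leeD2r _ (lotS lotpq)); rewrite two_level_lotteryE -EFinD lee_fin.
set X' := (fun z => _); set Y' := (fun z => q%:E < _)%E.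
have X'E z : X' z = (p < z) by rewrite /X' lte_fin.
have Y'E z : Y' z = (q < z) by rewrite /Y' lte_fin.
have upX' : upward X' by move=> z z' _ zz'; rewrite !X'E => /lt_le_trans; apply.
have upY' : upward Y' by move=> z z' _ zz'; rewrite !Y'E => /lt_le_trans; apply.
have hE i : high_others X v i = high_others X' v i.
  by apply: eq_card => j; rewrite !inE X'E Xv.
have lE i : low_others X Y v i = low_others X' Y' v i.
  by apply: eq_card => j; rewrite !inE X'E Xv Y'E Yv.
pose E := `]p, (p + t)] `|` `]q, (q + t)].
have muE : (mu E <= (2 * t)%:E)%E.
  rewrite mulr_natl mulr2n EFinD. apply: lebesgue_measureU_le => //.
    exact/lebesgue_measure_oc_le/ltW.
  exact/lebesgue_measure_oc_le/ltW.
apply: (le_trans (y := perf (lottery k X' Y') v + n%:R * (`|gp| * (2 * t)))).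
  apply: (performance_close (E := E)) => //.
  - by move=> i; exact: lottery_monotone.
  - by move=> i; exact: lottery_monotone.
  - exact: measurableU.
  - by move=> i; rewrite !lottery_at X'E Y'E Xv Yv hE lE.
  - by move=> i z _; exact: lottery_itv01.
  - by move=> i z _; exact: lottery_itv01.
  move=> i z /andP[z0 zv] /not_orP[/= zp zq].
  have zM : 0 <= z <= M by rewrite z0 (le_trans zv) //; case/andP: (vM i).
  have XzE : X z = (p < z) by apply: Xz => //; move: zp; rewrite in_itv.
  have YzE : Y z = (q < z) by apply: Yz => //; move: zq; rewrite in_itv.
  by rewrite !lottery_update X'E Y'E XzE YzE hE lE.
rewrite lerD2l.
have -> : n%:R * (`|gp| * (2 * t)) = (n%:R * (`|gp| * 2)) * t by ring.
rewrite -[leRHS](divfK (lt0r_neq0 c0)) mulrC ler_wpM2l ?ltW // /c; lra.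
Qed.

End UpperBound.
End Compare.

Section ZeroValues.
Context {R : realType} {n : nat}.
Variables (gv gp : R).
Implicit Types (x y : @allocation R n) (i j : 'I_n) (X Y : R -> bool).
Local Notation mu := (@lebesgue_measure R).
Local Notation perf := (performance gv gp).

Definition mix (s : R) x y : @allocation R n :=
  fun v i => (1 - s) * x v i + s * y v i.

Lemma mix_monotone s x y v i : 0 <= s <= 1 ->
  monotone_at x v i -> monotone_at y v i -> monotone_at (mix s x y) v i.
Proof.
move=> /andP[s0 s1] mx my z z' z0 zz' zv.
by rewrite /mix lerD // ler_wpM2l ?subr_ge0 ?mx ?my.
Qed.

Lemma performance_mix s x y v : (forall i, 0 <= v i) ->
  (forall i, monotone_at x v i) -> (forall i, monotone_at y v i) ->
  perf (mix s x y) v = (1 - s) * perf x v + s * perf y v.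
Proof.
move=> v0 mx my; rewrite /performance !mulr_sumr -big_split /=.
apply: eq_bigr => i _; rewrite /payment /mix.
have Ix := monotone_integrable (v0 i) (mx i).
have Iy := monotone_integrable (v0 i) (my i).
rewrite RintegralD ?RintegralZl //; first by ring.
- exact: (@integrableZl _ _ _ mu _ (measurable_itv _) (1 - s) _ Ix).
- exact: (@integrableZl _ _ _ mu _ (measurable_itv _) s _ Iy).
Qed.

Section UpperBound.
Variables (k : nat) (v : 'I_n -> R) (S : \bar R).
Hypothesis gp0 : gp != 0.
Hypothesis v0 : forall i, 0 <= v i.
Hypothesis lotS : forall p q : \bar R, (0 <= q <= p)%E ->
  ((perf (two_level_lottery k p q) v)%:E <= S)%E.

Lemma reject_all_le_sup : (0 <= S)%E.
Proof.
have := lotS (p := +oo%E) (q := +oo%E); rewrite leey lexx => /(_ isT).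
apply: le_trans; rewrite lee_fin performance0 // => i z _.
by rewrite two_level_lotteryE lottery_update.
Qed.

(* Agents of value 0 bring nothing but may use up units, so that a lottery
   admitting them is dominated by lotteries that do not. *)
Lemma lottery_zero_le_sup X Y : upward X -> upward Y -> ~~ X 0 -> Y 0 ->
  ((perf (lottery k X Y) v)%:E <= S)%E.
Proof.
move=> upX upY X0 Y0.
have Yz z : 0 <= z -> Y z by move=> z0; exact: upY Y0.
pose Y' (z : R) := 0 < z.
have upY' : upward Y' by move=> z z' _ zz' /lt_le_trans; exact.
have XY' z : 0 <= z -> X z -> Y' z.
  rewrite /Y' le_eqVlt => /predU1P[<-|//] X0'; by rewrite X0' in X0.
have Y'0 : ~~ Y' 0 by rewrite /Y' ltxx.
(* [x'] shuts out the agents of value 0, and [x''] the whole lower level. For [gp < 0 <= gv] the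
   rule [x'] does at least as well as [x]; for [gp > 0] a mixture of the two does. *)
pose x : @allocation R n := lottery k X Y.
pose x' : @allocation R n := lottery k X Y'.
pose x'' : @allocation R n := lottery k X X.
rewrite -/x.
have mx i : monotone_at x v i by exact: lottery_monotone.
have mx' i : monotone_at x' v i by exact: lottery_monotone.
have mx'' i : monotone_at x'' v i by exact: lottery_monotone.
have x'S : ((perf x' v)%:E <= S)%E by exact: lottery_le_sup.
have x''S : ((perf x'' v)%:E <= S)%E by exact: lottery_le_sup.
pose h := #|[set j | X (v j)]%SET|.
pose l := #|[set j | ~~ X (v j)]%SET|.
pose m := #|[set j | ~~ X (v j) && Y' (v j)]%SET|.
have ml : (m <= l)%N.
  by apply: subset_leq_card; apply/fintype.subsetP => j; rewrite !inE => /andP[].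
have hX i : X (v i) -> h = (high_others X v i).+1.
  by move=> Xi; rewrite high_othersE /h (cardsD1 i) inE Xi.
have hN i : ~~ X (v i) -> h = high_others X v i.
  by move=> /negbTE Xi; rewrite high_othersE /h (cardsD1 i) inE Xi.
have lX i : X (v i) -> low_others X Y v i = l.
  move=> Xi; apply: eq_card => j; rewrite !inE Yz // andbT.
  by case: eqP => // ->; rewrite Xi.
have mX i : X (v i) -> low_others X Y' v i = m.
  move=> Xi; apply: eq_card => j; rewrite !inE.
  by case: eqP => // ->; rewrite Xi.
have lN i : ~~ X (v i) -> (low_others X Y v i).+1 = l.
  move=> Xi; rewrite /l (cardsD1 i) inE Xi; congr (_.+1).
  by apply: eq_card => j; rewrite !inE Yz // andbT.
have mN i : ~~ X (v i) -> 0 < v i -> (low_others X Y' v i).+1 = m.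
  move=> Xi vi; rewrite /m (cardsD1 i) inE Xi /Y' vi; congr (_.+1).
  by apply: eq_card => j; rewrite !inE.
have NX i z : ~~ X (v i) -> 0 <= z <= v i -> X z = false.
  by move=> Xi /andP[z0 zv]; apply: contraNF Xi; exact: upX.
have trivial i y : v i = 0 -> gv * (v i * y v i) + gp * payment y v i = 0.
  by move=> vi; rewrite /payment vi !mul0r mulr0 set_itv1 Rintegral_set1 subr0 mulr0 addr0.
have /orP[gp_sign|gp_sign] : (gp < 0) || (0 < gp) by rewrite -neq_lt.
  have [gv0|gv_neg] := leP 0 gv; last first.
    apply: le_trans _ reject_all_le_sup; rewrite lee_fin.
    apply: performance_le0 => //; [|exact: ltW|by left; exact: ltW].
    by move=> i z _; case/andP: (lottery_itv01 k X Y [eta v with i |-> z] i).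
  (* Without the agents of value 0 the lower pool shrinks: lower shares grow and upper payments
     fall, while lower agents pay nothing under either rule. At [z = 0], where [x'] serves nobody,
     the comparison fails, but this is a null set. *)
  apply: le_trans _ x'S; rewrite lee_fin -[leRHS]addr0 -(mulr0 n%:R).
  apply: performance_le => i; rewrite addr0.
  have [vi0|vi0] := eqVneq (v i) 0; first by rewrite !trivial.
  have vi : 0 < v i by rewrite lt0r vi0 v0.
  have [Xi|Xi] := boolP (X (v i)).
    have xx' : x v i = x' v i by rewrite /x /x' !lottery_at Xi.
    rewrite xx' lerD2l.
    suff: payment x' v i <= payment x v i by move=> xx; rewrite ler_wnM2l // ltW.
    rewrite -[leRHS]addr0; apply: (payment_le (E := [set 0])) => //.
      by rewrite lebesgue_measure_set1.
    move=> z /andP[z0 zv]; rewrite xx' -addrA lerD2l /x /x' !lottery_update.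
    rewrite indicE; move: z0; rewrite le_eqVlt => /predU1P[<-|z0].
      rewrite mem_set //= (negbTE X0) (negbTE Y'0) Y0 oppr0.
      by rewrite addrC subr_ge0 share_le1.
    rewrite memNset ?addr0 ?lerN2 /=; last by move=> zE; rewrite zE ltxx in z0.
    case: ifP => // _; rewrite (Yz _ (ltW z0)) /Y' z0 lX // mX //.
    by apply: share_decr; rewrite /= ltnS ml.
  have xE : x v i = share (k - h) l.
    by rewrite /x lottery_at (negbTE Xi) Yz // -hN // lN.
  have x'E : x' v i = share (k - h) m.
    by rewrite /x' lottery_at (negbTE Xi) /Y' vi -hN // mN.
  have m0 : (0 < m)%N by rewrite -(mN i).
  apply: lerD; first by rewrite !ler_wpM2l ?xE ?x'E // share_decr ?m0.
  suff: payment x' v i <= payment x v i by move=> xx; rewrite ler_wnM2l // ltW.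
  rewrite -[leRHS]addr0; apply: (payment_le (E := [set 0])) => //.
    by rewrite lebesgue_measure_set1.
  move=> z zv; have /andP[z0 zvi] := zv.
  have -> : x v i - x [eta v with i |-> z] i = 0.
    by rewrite /x lottery_at lottery_update (negbTE Xi) (NX i z) // !Yz ?subrr.
  rewrite add0r indicE; move: z0; rewrite le_eqVlt => /predU1P[<-|z0].
    rewrite mem_set //=; have /andP[_ x1] := lottery_itv01 k X Y' v i.
    have /andP[x0 _] := lottery_itv01 k X Y' [eta v with i |-> 0] i.
    by move: x0 x1; rewrite -/x'; lra.
  rewrite memNset; last by move=> zE; rewrite zE ltxx in z0.
  by rewrite /x' lottery_at lottery_update (negbTE Xi) (NX i z) // /Y' vi z0 subrr.
pose C b : R := share (k - h) b.
(* With this weight the mixture gives lower agents of positive value exactly their share under [x].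
   If [C m = 0] the quotient is 0, and then either there is no such agent or no unit is left for
   them. *)
pose s := C l / C m.
have Cm0 : 0 <= C m by exact: share_ge0.
have s01 : 0 <= s <= 1.
  rewrite /s divr_ge0 ?share_ge0 //=.
  have [->|Cm] := eqVneq (C m) 0; first by rewrite invr0 mulr0 ler01.
  rewrite ler_pdivrMr ?lt0r ?Cm // mul1r share_decr // ml andbT.
  by rewrite lt0n; apply: contra_neq Cm => ->; rewrite /C /share minn0 mul0r.
have sCm : (0 < m)%N -> C l = s * C m.
  move=> m0; have [Cm|Cm] := eqVneq (C m) 0; last by rewrite divfK.
  rewrite Cm mulr0; apply/le_anti; rewrite share_ge0 andbT -Cm.
  by apply: share_decr; rewrite m0.
suff xmix : perf x v <= perf (mix s x'' x') v.
  apply: le_trans (_ : ((perf (mix s x'' x') v)%:E <= S)%E); first by rewrite lee_fin.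
  rewrite performance_mix //; case/andP: s01 => s0 s1.
  move: (perf x' v) (perf x'' v) x'S x''S => a b aS bS.
  have [ba|/ltW ab] := leP b a.
    apply: le_trans aS; rewrite lee_fin.
    have : 0 <= (1 - s) * (a - b) by rewrite mulr_ge0 ?subr_ge0.
    lra.
  apply: le_trans bS; rewrite lee_fin.
  have : 0 <= s * (b - a) by rewrite mulr_ge0 ?subr_ge0.
  lra.
have mmix i : monotone_at (mix s x'' x') v i by exact: mix_monotone.
rewrite -[leRHS]addr0 -(mulr0 n%:R).
apply: performance_le => i; rewrite addr0.
have [vi0|vi0] := eqVneq (v i) 0; first by rewrite !trivial.
have vi : 0 < v i by rewrite lt0r vi0 v0.
have xmixE : x v i = mix s x'' x' v i.
  rewrite /mix /x /x' /x'' !lottery_at; case: ifPn => Xi; first by ring.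
  by rewrite Yz // /Y' vi mulr0 add0r -hN // lN // mN // -sCm // -(mN i).
rewrite -xmixE lerD2l.
suff: payment x v i <= payment (mix s x'' x') v i.
  by move=> xx; rewrite ler_wpM2l // ltW.
rewrite -[leRHS]addr0; apply: (payment_le (E := set0)) => //.
  by rewrite measure0.
move=> z /andP[z0 zv]; rewrite indic0 addr0 -xmixE lerD2l lerN2.
have [Xi|Xi] := boolP (X (v i)); last first.
  have -> : x [eta v with i |-> z] i = x v i.
    by rewrite /x lottery_update lottery_at (negbTE Xi) (NX i z) ?z0 // !Yz.
  by rewrite xmixE -{2}(update_id v i); apply: mmix.
rewrite /mix /x /x' /x'' !lottery_update.
have [Xz|/negbTE Xz] := boolP (X z); first by rewrite -mulrDl subrK mul1r.
rewrite /= mulr0 add0r Yz //; case: ifPn => _; last by rewrite mulr0 share_ge0.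
rewrite lX // mX //.
have [kh|hk] := leqP k (high_others X v i).
  by rewrite (eqP kh) !share0 mulr0.
(* An upper agent who reports a lower value frees one unit and enters the lower pool, which is the
   situation of [share_ratio]. *)
have -> : (k - high_others X v i = (k - h).+1)%N by rewrite (hX i Xi) subnSK.
have [Cm|Cm] := eqVneq (C m) 0; first by rewrite /s Cm invr0 mulr0 mul0r share_ge0.
rewrite /s mulrAC ler_pdivrMr ?lt0r ?Cm //; apply: share_ratio.
rewrite ml andbT lt0n; apply: contra_neq Cm => ->.
by rewrite /C /share minn0 mul0r.
Qed.

Lemma highest_score_le_sup (w : R -> \bar R) :
  (forall a b, 0 <= a -> a <= b -> (w a <= w b)%E) ->
  ((perf (highest_score k w) v)%:E <= S)%E.
Proof.
move=> wmon; have [X [Y [upX upY XY xE]]] := highest_score_lottery k v0 wmon.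
rewrite (performance_ext _ _ xE) //.
have [Y0|Y0] := boolP (Y 0); last by apply: lottery_le_sup => // z _; exact: XY.
have [X0|X0] := boolP (X 0); last exact: lottery_zero_le_sup.
(* If the upper level contains 0 it contains everybody, and it can be relabelled as a lower level
   below an empty upper one. *)
rewrite (@performance_ext _ _ _ _ _ (lottery k xpred0 Y)) //; last first.
  move=> i z /andP[z0 _]; rewrite !lottery_update (upX 0) //= (upY 0) //.
  have -> : high_others xpred0 v i = 0%N.
    by apply: eq_card0 => j; rewrite !inE andbF.
  rewrite subn0; congr (share _ _.+1); apply: eq_card => j.
  by rewrite !inE (upX 0) // (upY 0).
by apply: lottery_zero_le_sup.
Qed.

End UpperBound.
End ZeroValues.

(** * Monotonicity of ironed virtual values *)

Section ConvexInterior.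
Context {R : realType}.
Implicit Types (c : R -> R) (a b r t h : R).

Lemma derive1_eps c r : derivable c r 1 -> forall e, 0 < e ->
  exists2 d, 0 < d & forall h, `|h| < d ->
    `|c (r + h) - c r - derive1 c r * h| <= e * `|h|.
Proof.
move=> dc e e0; rewrite derive1E.
have cvgD : h^-1 *: ((c \o shift r) (h *: 1) - c r) @[h --> 0^'] --> 'D_1 c r := dc.
move/cvgrPdist_le: cvgD => /(_ e e0); rewrite -nbhs_nearE => /nbhs_ballP[d /= d0 dB].
exists d => // h hd; have [->|h0] := eqVneq h 0.
  by rewrite addr0 subrr mulr0 subr0 normr0 mulr0.
have bh : ball 0 d h by rewrite -ball_normE /ball_ /= sub0r normrN.
have /= := dB h bh h0.
rewrite /GRing.scale /= mulr1 -(ler_pM2r (x := `|h|)) ?normr_gt0 // -normrM mulrBl.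
by rewrite mulrAC mulVf // mul1r distrC [h + r]addrC.
Qed.

Lemma derivable_eps c r (D : R) : (forall e, 0 < e ->
  exists2 d, 0 < d & forall h, `|h| < d ->
    `|c (r + h) - c r - D * h| <= e * `|h|) ->
  derivable c r 1 /\ derive1 c r = D.
Proof.
move=> cD.
have cvgD : h^-1 *: ((c \o shift r) (h *: 1) - c r) @[h --> 0^'] --> D.
  apply/cvgrPdist_le => e e0; have [d d0 dD] := cD e e0.
  rewrite -nbhs_nearE; apply/nbhs_ballP; exists d => //= h.
  move=> bh h0; have hd : `|h| < d by move: bh; rewrite -ball_normE /ball_ /= sub0r normrN.
  have hD := dD h hd; rewrite /GRing.scale /= mulr1 -(ler_pM2r (x := `|h|)) ?normr_gt0 //.
  by rewrite -normrM mulrBl mulrAC mulVf // mul1r distrC [h + r]addrC; exact: hD.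
split; first by apply/cvg_ex; exists D.
by rewrite derive1E; exact: cvg_lim cvgD.
Qed.

(** Only interior points: at 1 the values of the convex minorants may be unbounded, in which case
    [ironed_cumulative] takes the default value of [sup] there. *)
Definition convex_oo01 c := forall a b t, 0 < a < 1 -> 0 < b < 1 -> 0 <= t <= 1 ->
  c (t * a + (1 - t) * b) <= t * c a + (1 - t) * c b.

Variable c : R -> R.
Hypothesis cvx : convex_oo01 c.

(** Chord slopes increase: [r + s * d] lies between [r] and [r + d], while [r] lies between [r - d]
    and [r + s * d], with weight [(1 + s)^-1] on the latter. The step [d] may be negative. *)
Lemma convex_step r d s : 0 < r < 1 -> 0 < r + d < 1 -> 0 < r - d < 1 -> 0 <= s <= 1 ->
  s * (c r - c (r - d)) <= c (r + s * d) - c r <= s * (c (r + d) - c r).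
Proof.
move=> r01 rd rd' s01; apply/andP; split; last first.
  have := cvx rd r01 s01; rewrite (_ : s * (r + d) + _ = r + s * d); last ring.
  lra.
have [s0 s1] := andP s01; have s1' : 0 < 1 + s by lra.
have rs : 0 < r + s * d < 1.
  have -> : r + s * d = s * (r + d) + (1 - s) * r by ring.
  by case/andP: r01 rd => ? ? /andP[? ?]; nra.
have t01 : 0 <= (1 + s)^-1 <= 1.
  by rewrite invr_ge0 ltW //= invf_le1 //; lra.
have h := cvx rs rd' t01; have := ler_wpM2l (ltW s1') h.
have -> : (1 + s)^-1 * (r + s * d) + (1 - (1 + s)^-1) * (r - d) = r.
  by field; rewrite gt_eqF.
have -> : (1 + s) * ((1 + s)^-1 * c (r + s * d) + (1 - (1 + s)^-1) * c (r - d)) =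
    c (r + s * d) + s * c (r - d) by field; rewrite gt_eqF.
lra.
Qed.

(** By [convex_step], increments at [r] are at most linear, with a constant read off from the
    increments at a fixed distance [d] on both sides; [d] stays within half the distance to the
    boundary. *)
Lemma convex_continuous r : 0 < r < 1 -> {for r, continuous c}.
Proof.
move=> /andP[r0 r1].
pose d := Num.min r (1 - r) / 2.
have [dr dr1] : d <= r / 2 /\ d <= (1 - r) / 2.
  by rewrite /d !ler_pM2r ?invr_gt0 // !ge_min !lexx orbT.
have d0 : 0 < d by rewrite divr_gt0 // lt_min r0 subr_gt0.
have r01 : 0 < r < 1 by rewrite r0.
have [rd rd'] : 0 < r + d < 1 /\ 0 < r - d < 1 by lra.
pose K := `|c (r + d) - c r| + `|c (r - d) - c r|.
have K0 : 0 <= K by rewrite addr_ge0.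
have lip h : `|h| <= d -> `|c (r + h) - c r| <= K * (`|h| / d).
  move=> hd; have s01 : 0 <= `|h| / d <= 1.
    by rewrite divr_ge0 ?(ltW d0) //= ler_pdivrMr // mul1r.
  have [s0 s1] := andP s01.
  have bound u : u <= K -> (`|h| / d) * u <= K * (`|h| / d).
    by move=> uK; rewrite mulrC ler_wpM2r.
  have bp : c (r + d) - c r <= K by rewrite (le_trans (ler_norm _)) // lerDl.
  have bm : c (r - d) - c r <= K by rewrite (le_trans (ler_norm _)) // lerDr.
  rewrite ler_norml lerNl opprB; have [h0|h0] := leP 0 h.
    have -> : c (r + h) = c (r + `|h| / d * d).
      by rewrite divfK ?gt_eqF // ger0_norm.
    have /andP[l1 l2] := convex_step r01 rd rd' s01.
    rewrite (le_trans l2 (bound _ bp)) andbT (le_trans _ (bound _ bm)) //.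
    by rewrite -lerN2 opprB -mulrN opprB.
  have -> : c (r + h) = c (r + `|h| / d * (- d)).
    by rewrite mulrN divfK ?gt_eqF // ltr0_norm // opprK.
  have rd'' : 0 < r - - d < 1 by rewrite opprK.
  have /andP[] := convex_step r01 rd' rd'' s01; rewrite opprK => l1 l2.
  rewrite (le_trans l2 (bound _ bm)) andbT (le_trans _ (bound _ bp)) //.
  by rewrite -lerN2 opprB -mulrN opprB.
apply/cvgrPdist_le => e e0.
pose d' := Num.min d (e * d / (K + 1)).
have K10 : 0 < K + 1 by rewrite ltr_wpDl.
have d'0 : 0 < d' by rewrite lt_min d0 divr_gt0 // mulr_gt0.
rewrite -nbhs_nearE; apply/nbhs_ballP; exists d' => //= t rt.
have td : `|t - r| < d' by move: rt; rewrite /ball /= /ball_ /= distrC.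
rewrite distrC.
have -> : c t = c (r + (t - r)) by rewrite addrC subrK.
have [td1 td2] : `|t - r| <= d /\ `|t - r| <= e * d / (K + 1).
  by move: (ltW td); rewrite le_min => /andP.
apply: le_trans (lip _ td1) _.
rewrite mulrA ler_pdivrMr //; move: td2; rewrite ler_pdivlMr; last lra.
by apply: le_trans; rewrite mulrC ler_wpM2l //; lra.
Qed.

(* A parabola touching [c] from above at an interior point forces [c] to be
   derivable there. *)
Lemma convex_derivable_dense a b : 0 <= a -> a < b -> b <= 1 ->
  exists2 r, a < r < b & derivable c r 1.
Proof.
move=> a0 ab b1; pose m := (a + b) / 2; pose d := (b - a) / 4.
have d0 : 0 < d by rewrite /d; lra.
(* [K] is large enough for [g] to be larger at both ends [m - d] and [m + d] than at [m], so that
   its minimum is attained at an interior point [r]. *)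
pose K := (`|c (m + d) - c m| + `|c (m - d) - c m| + 1) / (d * d).
have K0 : 0 <= K.
  by apply: divr_ge0; [rewrite !addr_ge0 // ler01|exact: mulr_ge0 (ltW d0) (ltW d0)].
have Kd : K * (d * d) = `|c (m + d) - c m| + `|c (m - d) - c m| + 1.
  by rewrite divfK // gt_eqF // mulr_gt0.
pose g t := K * ((t - m) * (t - m)) - c t.
have seg01 t : m - d <= t <= m + d -> 0 < t < 1 /\ a < t < b.
  by rewrite /m /d; lra.
have gcont : {within `[m - d, m + d], continuous g}.
  apply: continuous_in_subspaceT => t; rewrite inE /= in_itv /= => /seg01[t01 _].
  apply: cvgB; last exact: convex_continuous.
  apply: cvgM; first exact: cvg_cst.
  by apply: cvgM; apply: cvgB; by [exact: cvg_id|exact: cvg_cst].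
have mdd : m - d <= m + d by lra.
have [r rmd rmin] := EVT_min mdd gcont.
have gm : g r <= g m by apply: rmin; rewrite in_itv /=; lra.
have gmd : g m < g (m - d) /\ g m < g (m + d).
  rewrite /g !subrr mul0r mulr0.
  have -> : m - d - m = - d by ring.
  have -> : m + d - m = d by ring.
  rewrite mulrNN Kd.
  have := ler_norm (c (m + d) - c m); have := ler_norm (c (m - d) - c m).
  have := normr_ge0 (c (m + d) - c m); have := normr_ge0 (c (m - d) - c m).
  by lra.
have rmd' : m - d < r < m + d.
  move: rmd; rewrite in_itv /= => /andP[r1 r2]; case: gmd => g1 g2.
  rewrite !lt_neqAle r1 r2 !andbT; apply/andP; split; apply/eqP => rE.
    by move: gm; rewrite -rE; lra.
  by move: gm; rewrite rE; lra.
have [r01 rab] : 0 < r < 1 /\ a < r < b by apply: seg01; lra.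
exists r => //.
(* The candidate is the slope of the parabola at [r]. Minimality bounds the increments of [c] from
   above on both sides, and midpoint convexity turns the bound at [- h] into a lower bound at
   [h]. *)
have [] // := @derivable_eps c r (2 * K * (r - m)).
move=> e e0; pose d1 := Num.min (r - (m - d)) (m + d - r).
have d10 : 0 < d1 by rewrite lt_min; lra.
exists (Num.min d1 (e / (K + 1))).
  by rewrite lt_min d10 divr_gt0 //; lra.
move=> h; rewrite lt_min => /andP[hd he].
have he' : K * `|h| <= e.
  move: (ltW he); rewrite ler_pdivlMr; last lra.
  by apply: le_trans; rewrite mulrC ler_wpM2l //; lra.
have /andP[h1 h2] : (`|h| < r - (m - d)) && (`|h| < m + d - r) by rewrite -lt_min.
have rin s : `|s| = `|h| -> m - d <= r + s <= m + d.
  by move=> sh; have := ler_norm s; have := ler_norm (- s); rewrite normrN sh; lra.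
have up s : `|s| = `|h| -> c (r + s) - c r <= 2 * K * (r - m) * s + K * (s * s).
  move=> sh; have := rmin (r + s); rewrite in_itv /= => /(_ (rin _ sh)).
  rewrite /g; set u := c r; set w := c (r + s).
  have -> : K * ((r + s - m) * (r + s - m)) = K * ((r - m) * (r - m)) +
    (2 * K * (r - m) * s + K * (s * s)) by ring.
  by lra.
have mid : 2 * c r <= c (r + h) + c (r - h).
  have hm : `|- h| = `|h| by rewrite normrN.
  have [rh _] := seg01 _ (rin h erefl); have [rh' _] := seg01 _ (rin _ hm).
  have := @cvx _ _ (2^-1) rh rh' ltac:(lra).
  have -> : 2^-1 * (r + h) + (1 - 2^-1) * (r - h) = r by field.
  by lra.
have := up h erefl; have := up (- h) (normrN h).
have hh : K * (h * h) <= e * `|h|.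
  have -> : h * h = `|h| * `|h| by rewrite -normrM ger0_norm // -expr2 sqr_ge0.
  by rewrite mulrA ler_wpM2r.
rewrite mulrNN mulrN ler_norml.
move: (2 * K * (r - m) * h) (K * (h * h)) (e * `|h|) hh mid.
by move=> A B C; lra.
Qed.

(** On a short step from [r] towards [t] the increment is the derivative term up to an error
    proportional to the step, and by convexity it is at most the same fraction of [c t - c r]. *)
Lemma convex_tangent r t : derivable c r 1 -> 0 < r < 1 -> 0 < t < 1 ->
  derive1 c r * (t - r) <= c t - c r.
Proof.
move=> dr r01 t01; apply/ler_addgt0Pr => e e0.
have [->|tr] := eqVneq t r; first by rewrite !subrr mulr0 add0r ltW.
have tr0 : 0 < `|t - r| by rewrite normr_gt0 subr_eq0.
have [d d0 dD] := derive1_eps dr (divr_gt0 e0 tr0).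
pose s := Num.min 1 (d / (2 * `|t - r|)).
have s0 : 0 < s by rewrite lt_min ltr01 divr_gt0 // mulr_gt0.
have s1 : s <= 1 by rewrite ge_min lexx.
have sd : s * `|t - r| < d.
  have : s <= d / (2 * `|t - r|) by rewrite ge_min lexx orbT.
  rewrite ler_pdivlMr ?mulr_gt0 // mulrCA; move: (s * `|t - r|) d0 => u; lra.
have := dD (s * (t - r)); rewrite normrM (gtr0_norm s0) => /(_ sd).
rewrite [leRHS]mulrCA divfK ?gt_eqF // ler_norml => /andP[+ _].
have := cvx t01 r01 (_ : 0 <= s <= 1); rewrite (ltW s0) s1 => /(_ isT).
have -> : s * t + (1 - s) * r = r + s * (t - r) by ring.
move=> h1 h2; rewrite -(ler_pM2l s0).
have -> : s * (derive1 c r * (t - r)) = derive1 c r * (s * (t - r)) by ring.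
have -> : s * (c t - c r + e) = s * c t + (1 - s) * c r - c r + s * e by ring.
by move: h1 h2; move: (derive1 c r * _) (s * e) => A B; lra.
Qed.

Lemma convex_derive1_le r t : derivable c r 1 -> derivable c t 1 ->
  0 < r < 1 -> 0 < t < 1 -> r <= t -> derive1 c r <= derive1 c t.
Proof.
move=> dr dt r01 t01; rewrite le_eqVlt => /predU1P[->//|rt].
have h1 := convex_tangent dr r01 t01; have h2 := convex_tangent dt t01 r01.
have tr : 0 < t - r by rewrite subr_gt0.
by rewrite -(ler_pM2r tr); move: h1 h2; rewrite -(opprB t r) mulrN; lra.
Qed.

End ConvexInterior.

(** * The ironed slope is non-decreasing *)

Section Ironing.
Context {R : realType}.
Variables (gv gp : R) (f : R -> R).
Local Notation mu := (@lebesgue_measure R).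
Local Notation Phi := (ironed_cumulative gv gp f).
Hypothesis ironf : ironable gv gp f.

Lemma convex_minorant01 phi : convex_minorant gv gp f phi -> forall a b t,
  0 <= a <= 1 -> 0 <= b <= 1 -> 0 <= t <= 1 ->
  phi (t * a + (1 - t) * b) <= t * phi a + (1 - t) * phi b.
Proof.
move=> [cvx _] a b t a01 b01 /andP[t0 t1].
have := cvx (@Itv01 _ t t0 t1) a b.
rewrite !inE /= !in_itv /= => /(_ a01 b01).
rewrite !convRE /=; exact.
Qed.

Lemma minorant_le phi q : convex_minorant gv gp f phi -> 0 <= q < 1 ->
  phi q <= fine (cumulative_virtual gv gp f q).
Proof.
move=> [_ le_phi] /andP[q0 q1]; have [fin _] := ironf.
rewrite -lee_fin fineK; last by apply: fin; rewrite q0.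
by apply: le_phi; rewrite q0 ltW.
Qed.

Lemma ironed_ub phi q : convex_minorant gv gp f phi -> 0 <= q < 1 -> phi q <= Phi q.
Proof.
move=> mphi q01; apply: ub_le_sup; last by exists phi.
by exists (fine (cumulative_virtual gv gp f q)) => _ [psi mpsi <-]; exact: minorant_le.
Qed.

Lemma ironed_le (q M : R) : (exists phi, convex_minorant gv gp f phi) ->
  (forall phi, convex_minorant gv gp f phi -> phi q <= M) -> Phi q <= M.
Proof.
move=> [phi mphi] leM; apply: ge_sup; first by exists (phi q), phi.
by move=> _ [psi mpsi <-]; exact: leM.
Qed.

(** A pointwise supremum of convex functions is convex wherever it is finite; without any minorant
    it is the constant 0, the supremum of the empty set. *)
Lemma ironed_convex : convex_oo01 Phi.
Proof.
move=> a b t a01 b01 t01.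
have [ex|nex] := pselect (exists phi, convex_minorant gv gp f phi); last first.
  have Phi0 q : Phi q = 0.
    rewrite /ironed_cumulative (_ : [set _ | _ in _] = set0) ?sup0 //.
    by rewrite -subset0 => u [phi mphi _]; apply: nex; exists phi.
  by rewrite !Phi0 !mulr0 addr0.
have /andP[a0 a1] := a01; have /andP[b0 b1] := b01; have /andP[t0 t1] := t01.
apply: ironed_le => // phi mphi.
have a01' : 0 <= a <= 1 by rewrite !ltW.
have b01' : 0 <= b <= 1 by rewrite !ltW.
apply: (le_trans (convex_minorant01 mphi a01' b01' t01)).
by apply: lerD; apply: ler_wpM2l; rewrite ?subr_ge0 // ironed_ub // ltW.
Qed.

Let D := [set r | derivable Phi r 1].
Let slope (r : R) : \bar R := (derive1 Phi r)%:E.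

(** A running supremum of derivatives: it is monotone everywhere, hence has one-sided limits, and it
    agrees with the derivative at the interior points where there is one. *)
Let env (r : R) : \bar R := ereal_sup [set slope d | d in [set d | D d /\ 0 < d <= r]].

Let env_le : {homo env : r t / r <= t >-> (r <= t)%E}.
Proof.
move=> r t rt; apply: le_ereal_sup => _ [d [Dd /andP[d0 dr]] <-].
by exists d => //; split => //; rewrite d0 (le_trans dr).
Qed.

Let envE r : D r -> 0 < r < 1 -> env r = slope r.
Proof.
move=> Dr /andP[r0 r1]; apply/le_anti/andP; split.
  apply: ge_ereal_sup => _ [d [Dd /andP[d0 dr]] <-]; rewrite lee_fin.
  have r01 : 0 < r < 1 by rewrite r0.
  have d01 : 0 < d < 1 by rewrite d0 (le_lt_trans dr).
  exact: (convex_derive1_le ironed_convex Dd Dr d01 r01 dr).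
by apply: ereal_sup_ubound; exists r => //; split => //; rewrite r0 lexx.
Qed.

(** Properness, which comes from the density of the points of derivability, is what lets a
    convergence statement determine the [lim] in [ironed_slope]. *)
Lemma within_derivable_right (q : R) : 0 <= q < 1 -> ProperFilter (within D q^'+).
Proof.
move=> /andP[q0 q1]; have FF : Filter (within D q^'+) by exact: within_filter.
apply: Build_ProperFilter.
rewrite /within /at_right /= => /nbhs_ballP[e /= e0 eP].
have qm : q < Num.min 1 (q + e) by rewrite lt_min q1 ltrDl.
have m1 : Num.min 1 (q + e) <= 1 by rewrite ge_min lexx.
have [r /andP[qr rm] Dr] := convex_derivable_dense ironed_convex q0 qm m1.
apply: (eP r) => //; rewrite -ball_normE /ball_ /= distrC gtr0_norm ?subr_gt0 //.
by rewrite ltrBlDl; move: rm; rewrite lt_min => /andP[].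
Qed.

Lemma within_derivable_left : ProperFilter (within D 1^'-).
Proof.
have FF : Filter (within D 1^'-) by exact: within_filter.
apply: Build_ProperFilter.
rewrite /within /at_left /= => /nbhs_ballP[e /= e0 eP].
have qm : Num.max 0 (1 - e) < 1 by rewrite gt_max ltr01 ltrBlDr ltrDl.
have m0 : 0 <= Num.max 0 (1 - e) by rewrite le_max lexx.
have [r /andP[mr r1] Dr] := convex_derivable_dense ironed_convex m0 qm (lexx _).
apply: (eP r) => //; rewrite -ball_normE /ball_ /= gtr0_norm ?subr_gt0 //.
by rewrite ltrBlDr -ltrBlDl; move: mr; rewrite gt_max => /andP[].
Qed.

Lemma ironed_slope_right (q : R) : 0 <= q < 1 ->
  ironed_slope gv gp f q = ereal_inf [set env r | r in `]q, 1[].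
Proof.
move=> q01; have [q0 q1] := andP q01; rewrite /ironed_slope q1.
apply: (cvg_lim (@ereal_hausdorff R) (FF := within_derivable_right q01)).
have envc : env r @[r --> q^'+] --> ereal_inf [set env r | r in `]q, 1[].
  by apply: nondecreasing_at_right_cvge => // r t _ _; exact: env_le.
apply: cvg_trans (cvg_within_filter D envc); apply: near_eq_cvg.
rewrite near_withinE; near=> r => Dr.
have qr : q < r by near: r; exact: nbhs_right_gt.
have r1 : r < 1 by near: r; exact: nbhs_right_lt.
by apply: envE => //; rewrite (le_lt_trans q0 qr).
Unshelve. all: by end_near. Qed.

Lemma ironed_slope_left :
  ironed_slope gv gp f 1 = ereal_sup [set env r | r in `]0, 1[].
Proof.
rewrite /ironed_slope ltxx.
apply: (cvg_lim (@ereal_hausdorff R) (FF := within_derivable_left)).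
have envc : env r @[r --> 1^'-] --> ereal_sup [set env r | r in `]0, 1[].
  apply/cvg_at_leftNP.
  have -> : [set env r | r in `]0, 1[] = [set (env \o -%R) r | r in `](-1), 0[].
    apply/seteqP; split => _ [r /= r01 <-]; exists (- r) => //=; rewrite ?opprK //;
      by move: r01; rewrite !in_itv /= => /andP[? ?]; rewrite ?oppr_lt0 ?oppr_gt0; lra.
  apply: nonincreasing_at_right_cvge => [|r t _ _ rt]; first by rewrite bnd_simp; lra.
  by apply: env_le; rewrite lerN2.
apply: cvg_trans (cvg_within_filter D envc); apply: near_eq_cvg.
rewrite near_withinE; near=> r => Dr.
have r0 : 0 < r by near: r; apply: nbhs_left_gt.
have r1 : r < 1 by near: r; exact: nbhs_left_lt.
by apply: envE => //; rewrite r0.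
Unshelve. all: by end_near. Qed.

Lemma ironed_slope_le (q r : R) : 0 <= q -> q <= r -> r <= 1 ->
  (ironed_slope gv gp f q <= ironed_slope gv gp f r)%E.
Proof.
move=> q0; rewrite le_eqVlt => /predU1P[->//|qr r1].
have q01 : 0 <= q < 1 by rewrite q0 (lt_le_trans qr).
(* The value of [env] at the midpoint separates the two slopes: it is among the values of the
   infimum for [q], and below all those for [r < 1], or among those of the supremum if [r = 1]. *)
pose m := (q + r) / 2.
have mq : q < m < r by rewrite /m; lra.
rewrite (ironed_slope_right q01).
apply: (@le_trans _ _ (env m)).
  by apply: ereal_inf_lbound; exists m => //=; rewrite in_itv /=; lra.
move: r1; rewrite le_eqVlt => /predU1P[r1|r1].
  rewrite r1 ironed_slope_left; apply: ereal_sup_ubound.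
  by exists m => //=; rewrite in_itv /=; lra.
rewrite ironed_slope_right; last by lra.
apply: le_ereal_inf_tmp => _ [t /= + <-]; rewrite in_itv /= => t1.
by apply: env_le; lra.
Qed.

Hypothesis densf : valuation_density f.

Lemma dist_itv01 x : 0 <= dist f x <= 1.
Proof.
have [mf f0 f1] := densf.
have le1 : (\int[mu]_(t in `[0%R, x]) (f t)%:E <= 1)%E.
  rewrite -f1; apply: ge0_subset_integral => //.
  - exact/measurable_EFinP.
  - by move=> t /=; rewrite in_itv /= andbT lee_fin; exact: f0.
  - by move=> t /=; rewrite !in_itv /= => /andP[->].
have ge0 : (0 <= \int[mu]_(t in `[0%R, x]) (f t)%:E)%E.
  by apply: integral_ge0 => t /=; rewrite in_itv /= lee_fin => /andP[t0 _]; exact: f0.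
rewrite /dist /Rintegral fine_ge0 //= -lee_fin fineK //.
by rewrite ge0_fin_numE // (le_lt_trans le1) // ltry.
Qed.

Lemma dist_le x y : x <= y -> dist f x <= dist f y.
Proof.
move=> xy; have [mf f0 f1] := densf.
have sub z : `[0, z] `<=` (`[0, +oo[ : set R).
  by move=> t /=; rewrite !in_itv /= => /andP[->].
have fin z : (\int[mu]_(t in `[0%R, z]) (f t)%:E)%E \is a fin_num.
  rewrite ge0_fin_numE; last first.
    by apply: integral_ge0 => t /sub /=; rewrite in_itv /= andbT lee_fin; exact: f0.
  apply: (@le_lt_trans _ _ 1%E); last exact: ltry.
  rewrite -f1; apply: ge0_subset_integral => //; first exact/measurable_EFinP.
  by move=> t /=; rewrite in_itv /= andbT lee_fin; exact: f0.
rewrite /dist /Rintegral fine_le //; apply: ge0_subset_integral => //.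
- by apply/measurable_EFinP; exact: measurable_funS mf.
- by move=> t /sub /=; rewrite in_itv /= andbT lee_fin; exact: f0.
- by move=> t /=; rewrite !in_itv /= => /andP[-> tx]; exact: le_trans xy.
Qed.

Lemma ironed_virtual_value_le x y : x <= y ->
  (ironed_virtual_value gv gp f x <= ironed_virtual_value gv gp f y)%E.
Proof.
move=> xy; have /andP[x0 _] := dist_itv01 x; have /andP[_ y1] := dist_itv01 y.
by apply: ironed_slope_le => //; exact: dist_le.
Qed.

End Ironing.

(** * Distributions with prescribed virtual values *)

Section BoundedBelow.
Context d {T : measurableType d} {R : realType} (mu : {measure set T -> \bar R}).

(** The negative part is bounded on a set of finite measure, so only the positive part can have an
    infinite integral. This covers distributions for which [cumulative_virtual] is infinite at 1. *)
Lemma integrable_or_pinfty (D : set T) (f : T -> R) (a : R) :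
  measurable D -> (mu D < +oo)%E -> measurable_fun D f ->
  (forall x, D x -> a <= f x) ->
  mu.-integrable D (EFin \o f) \/ (\int[mu]_(x in D) (f x)%:E = +oo)%E.
Proof.
move=> mD muD mf af; pose fE := EFin \o f.
have mfE : measurable_fun D fE by exact/measurable_EFinP.
have neg : (\int[mu]_(x in D) fE^\- x < +oo)%E.
  apply: (@le_lt_trans _ _ (\int[mu]_(x in D) (`|a|)%:E)%E).
    apply: ge0_le_integral => //; first exact: measurable_funeneg.
    move=> x Dx; rewrite funenegE /fE /= ge_max !lee_fin normr_ge0 andbT; have := af x Dx; have := ler_norm (- a).
    by rewrite normrN; lra.
  have : mu D \is a fin_num by rewrite ge0_fin_numE.
  by rewrite integral_cst //; case: (mu D) => // r _; rewrite -EFinM ltry.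
have [pos|] := ltP (\int[mu]_(x in D) fE^\+ x)%E +oo%E; last first.
  rewrite leye_eq => /eqP pos; right; rewrite integralE pos.
  have : (\int[mu]_(x in D) fE^\- x)%E \is a fin_num.
    by rewrite ge0_fin_numE // integral_ge0.
  by case: (\int[mu]_(x in D) fE^\- x)%E.
left; apply/integrableP; split=> //.
under eq_integral do rewrite -/((abse \o fE) _) fune_abse.
rewrite ge0_integralD //; first exact: lte_add_pinfty.
- exact: measurable_funepos.
- exact: measurable_funeneg.
Qed.

End BoundedBelow.

(** * Monotone continuous virtual values need no ironing *)

Section TangentLines.
Context {R : realType}.
Variables (gv gp : R) (f : R -> R).
Local Notation mu := (@lebesgue_measure R).
Local Notation Phi := (ironed_cumulative gv gp f).
Local Notation H := (cumulative_virtual gv gp f).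

Lemma ironed_slope_eq (q l : R) (h : R -> R) : ironable gv gp f -> 0 <= q < 1 ->
  (forall r, q < r < 1 -> derivable Phi r 1 /\ derive1 Phi r = h r) ->
  (forall e, 0 < e -> exists2 d, 0 < d &
    forall r, q < r -> r < q + d -> r < 1 -> `|h r - l| <= e) ->
  ironed_slope gv gp f q = l%:E.
Proof.
move=> ironf q01 dPhi hl; have [q0 q1] := andP q01.
rewrite /ironed_slope q1.
apply: (cvg_lim (@ereal_hausdorff R) (FF := within_derivable_right ironf q01)).
apply: (@cvg_within_filter _ _ (fun r => (derive1 Phi r)%:E) _ _ _ [set r | derivable Phi r 1]).
apply: cvg_EFin; first by near=> r.
apply/cvgrPdist_le => e e0; have [d d0 hd] := hl e e0.
near=> r.
have qr : q < r by near: r; exact: nbhs_right_gt.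
have rd : r < q + d by near: r; apply: nbhs_right_lt; rewrite ltrDl.
have r1 : r < 1 by near: r; exact: nbhs_right_lt.
rewrite /= distrC (_ : derive1 Phi r = h r); first exact: hd.
by have [] := dPhi r; rewrite ?qr.
Unshelve. all: by end_near. Qed.

Lemma affine_minorant (a b : R) :
  (forall q, 0 <= q <= 1 -> ((a + b * q)%:E <= H q)%E) ->
  convex_minorant gv gp f (fun q => a + b * q).
Proof.
move=> le_H; split=> // t x y _ _; rewrite [leRHS]convRE /unstable.onem.
have -> : conv t x y = t%:num * x + (1 - t%:num) * y :> R by [].
by rewrite le_eqVlt; apply/orP; left; apply/eqP; ring.
Qed.

Local Notation h := (quantile_virtual gv gp f).
Hypothesis h_le : forall r t, 0 <= r -> r <= t -> t < 1 -> h r <= h t.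
Hypothesis h_lb : exists a, forall r, 0 <= r <= 1 -> a <= h r.
Hypothesis h_cont : forall r, 0 <= r < 1 -> forall e, 0 < e ->
  exists2 d, 0 < d & forall t, 0 <= t < 1 -> `|t - r| < d -> `|h t - h r| <= e.

Let h_int (q : R) : 0 <= q < 1 -> mu.-integrable `[0, q] (EFin \o h).
Proof.
move=> /andP[q0 q1]; apply: nondecreasing_integrable => // z z' z0 zz' zq.
by apply: h_le => //; exact: le_lt_trans q1.
Qed.

Let h_meas : measurable_fun (`[0, 1] : set R) h.
Proof.
have -> : `[0, 1]%classic = ([set 0] `|` `]0, 1[) `|` [set 1] :> set R.
  by rewrite setU1itv ?setUitv1 // bnd_simp.
apply/measurable_funU => //; first exact: measurableU.
split; last exact: measurable_fun_set1.
apply/measurable_funU => //; split; first exact: measurable_fun_set1.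
apply: open_continuous_measurable_fun => // r; rewrite inE /= in_itv /= => /andP[r0 r1].
apply/cvgrPdist_le => e e0.
have r01 : 0 <= r < 1 by rewrite ltW.
have [d d0 hd] := h_cont r01 e0.
rewrite -nbhs_nearE; apply/nbhs_ballP; exists (Num.min d (Num.min r (1 - r))).
  by rewrite /= !lt_min d0 r0 subr_gt0.
move=> t rt; have : `|t - r| < Num.min d (Num.min r (1 - r)).
  by move: rt; rewrite /ball /= /ball_ /= distrC.
rewrite !lt_min => /and3P[td tr t1]; rewrite distrC; apply: hd => //.
by have := ler_norm (t - r); have := ler_norm (- (t - r)); rewrite normrN; lra.
Qed.

Let h_int1 : mu.-integrable `[0, 1] (EFin \o h) \/ H 1 = +oo%E.
Proof.
have [a ha] := h_lb; apply: (@integrable_or_pinfty _ _ _ mu _ h a) => //.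
exact/compact_finite_measure/segment_compact.
Qed.

Let H_fin (q : R) : mu.-integrable `[0, q] (EFin \o h) ->
  H q = (\int[mu]_(r in `[0, q]) h r)%:E.
Proof. by move=> hq; rewrite /Rintegral fineK //; exact: integrable_fin_num. Qed.

Lemma tangent_ironable : ironable gv gp f.
Proof.
split=> [q q01|]; first by rewrite H_fin //; exact: h_int.
by case: h_int1 => [h1|->]; rewrite ?ltNyr // H_fin // ltNyr.
Qed.

(** As [h] is non-decreasing, its integral between [r] and [q] is compared with that of the constant
    [h r]: the cumulative function lies above its tangents. *)
Let h_tangent (r q : R) : 0 <= r < 1 -> 0 <= q <= 1 ->
  mu.-integrable `[0, q] (EFin \o h) ->
  h r * (q - r) <= \int[mu]_(t in `[0, q]) h t - \int[mu]_(t in `[0, r]) h t.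
Proof.
move=> r01 /andP[q0 q1] hq; have [r0 r1] := andP r01.
have cst_oc (a b c : R) : a <= b -> \int[mu]_(t in `]a, b]) c = c * (b - a).
  move=> ab; rewrite Rintegral_cst //= lebesgue_measure_itv /= lte_fin.
  by move: ab; rewrite le_eqVlt => /predU1P[->|->] //=; rewrite ltxx subrr.
have cst_oo (a b c : R) : a <= b -> \int[mu]_(t in `]a, b[) c = c * (b - a).
  move=> ab; rewrite Rintegral_cst //= lebesgue_measure_itv /= lte_fin.
  by move: ab; rewrite le_eqVlt => /predU1P[->|->] //=; rewrite ltxx subrr.
have [rq|qr] := leP r q.
  rewrite Rintegral_itvB ?bnd_simp //.
  have sub : `]r, q[ `<=` `[0, q].
    by move=> t /=; rewrite !in_itv /= => /andP[rt tq]; rewrite !ltW ?(le_lt_trans r0).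
  have hoo : mu.-integrable `]r, q[ (EFin \o h) by exact: integrableS hq.
  rewrite -Rintegral_itv_bndo_bndc // -cst_oo //; apply: le_Rintegral => //.
    by apply: integrableS (integrable_cst_itv r q (h r)) => //; exact: subset_itv_oo_cc.
  move=> t /=; rewrite in_itv /= => /andP[rt tq]; apply: h_le => //; first exact: ltW.
  exact: lt_le_trans q1.
rewrite -lerN2 opprB (Rintegral_itvB (h_int r01)) ?bnd_simp ?(ltW qr) //.
rewrite -mulrN opprB -cst_oc ?(ltW qr) //; apply: le_Rintegral => //.
- apply: integrableS (h_int r01) => //.
  by move=> t /=; rewrite !in_itv /= => /andP[qt ->]; rewrite ltW ?(le_lt_trans q0).
- by apply: integrableS (integrable_cst_itv q r (h r)) => //; exact: subset_itv_oc_cc.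
- move=> t /=; rewrite in_itv /= => /andP[qt tr]; apply: h_le => //.
  by rewrite ltW ?(le_lt_trans q0).
Qed.

(** The tangent at [r] is a convex minorant that touches the cumulative function at [r], so the
    largest minorant touches it there as well. *)
Let PhiE (r : R) : 0 <= r < 1 -> Phi r = \int[mu]_(t in `[0, r]) h t.
Proof.
move=> r01; have [r0 r1] := andP r01.
pose I := \int[mu]_(t in `[0, r]) h t.
have mline : convex_minorant gv gp f (fun q => (I - h r * r) + h r * q).
  apply: affine_minorant => q /andP[q0]; rewrite le_eqVlt => /predU1P[->|q1].
    case: h_int1 => [h1|->]; last exact: leey.
    rewrite H_fin // lee_fin; have := h_tangent r01 (_ : 0 <= 1 <= 1) h1.
    by rewrite ler01 lexx -/I => /(_ isT); rewrite mulrBr; lra.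
  have hq : mu.-integrable `[0, q] (EFin \o h) by apply: h_int; rewrite q0.
  rewrite H_fin // lee_fin; have := h_tangent r01 (_ : 0 <= q <= 1) hq.
  by rewrite q0 ltW // -/I => /(_ isT); rewrite mulrBr; lra.
apply/le_anti/andP; split.
  apply: ironed_le => [|phi mphi]; first by eexists; exact: mline.
  apply: (le_trans (minorant_le tangent_ironable mphi r01)).
  by rewrite H_fin //; exact: h_int.
by have := ironed_ub tangent_ironable mline r01; rewrite subrK.
Qed.

(* The cumulative virtual value is convex and its tangents are minorants, so
   ironing does not change it. *)
Lemma tangent_ironed_slope (q : R) : 0 <= q < 1 -> ironed_slope gv gp f q = (h q)%:E.
Proof.
move=> q01; have [q0 q1] := andP q01.
apply: (@ironed_slope_eq _ _ h tangent_ironable q01); last first.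
  move=> e e0; have [d d0 hd] := h_cont q01 e0; exists d => // r qr rd r1.
  apply: hd; first by rewrite r1 ltW // (le_lt_trans q0).
  by rewrite gtr0_norm ?subr_gt0 // ltrBlDl.
move=> r /andP[qr r1]; have r0 : 0 < r := le_lt_trans q0 qr.
have r01 : 0 <= r < 1 by rewrite ltW.
apply: derivable_eps => e e0; have [d d0 hd] := h_cont r01 e0.
exists (Num.min d (Num.min r (1 - r))); first by rewrite !lt_min d0 r0 subr_gt0.
move=> t; rewrite !lt_min => /and3P[td tr t1].
have rt01 : 0 <= r + t < 1.
  by have := ler_norm t; have := ler_norm (- t); rewrite normrN; lra.
have rt01' : 0 <= r + t <= 1 by case/andP: rt01 => -> /ltW.
rewrite !PhiE //.
(* The tangents at [r] and at [r + t] enclose the increment, so the error is at most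
   [(h (r + t) - h r) * t], which continuity of [h] controls. *)
have t1' := h_tangent r01 rt01' (h_int rt01).
have r01' : 0 <= r <= 1 by rewrite !ltW.
have t2' := h_tangent rt01 r01' (h_int r01).
have := hd _ rt01; rewrite addrAC subrr add0r => /(_ td) hdt.
apply: (@le_trans _ _ (`|h (r + t) - h r| * `|t|)); last by rewrite ler_wpM2r.
rewrite -normrM; apply: (@le_trans _ _ ((h (r + t) - h r) * t)); last exact: ler_norm.
have e1 : r + t - r = t by ring.
have e2 : r - (r + t) = - t by ring.
move: t1' t2'; rewrite e1 e2 mulrN.
move: (h (r + t)) (h r) => u w.
move: (\int[mu]_(_ in _) _) (\int[mu]_(_ in _) _) => A B t1' t2'.
by rewrite mulrBl ger0_norm; lra.
Qed.

End TangentLines.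

Section PositivePart.
Context {R : realType}.
Implicit Types x y : R.

(** This form of max(x, 0) inherits its continuity from the norm. *)
Definition ppart x : R := (x + `|x|) / 2.

Lemma ppart_ge0 x : 0 <= ppart x.
Proof. by rewrite divr_ge0 //; have := ler_norm (- x); rewrite normrN; lra. Qed.

Lemma ppart_id x : 0 <= x -> ppart x = x.
Proof. by move=> x0; rewrite /ppart ger0_norm //; field. Qed.

Lemma ppart_eq0 x : x <= 0 -> ppart x = 0.
Proof. by move=> x0; rewrite /ppart ler0_norm // subrr mul0r. Qed.

Lemma continuous_ppart : continuous ppart.
Proof.
move=> x; apply: cvgM; last exact: cvg_cst.
by apply: cvgD; [exact: cvg_id|exact: norm_continuous].
Qed.

End PositivePart.

(** * The distribution with a given virtual value function *)

Section PrescribedVirtualValue.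
Context {R : realType}.
Variables (gv gp : R) (phi : R -> R) (C : R).
Implicit Types x y r t e : R.
Local Notation mu := (@lebesgue_measure R).
Hypothesis gp0 : gp != 0.
Hypothesis phi_cont : continuous phi.
Hypothesis phi_le : forall x y, x <= y -> phi x <= phi y.
Hypothesis phi_bound : forall x, 0 <= x ->
  0 < ((gv + gp) * x - phi x) / gp <= C * (1 + x).

(** The ratio (1 - F) / f obtained by solving [virtual_value = phi]. Composing with [ppart] extends
    it continuously and positively to negative arguments. *)
Let mills (x : R) := ((gv + gp) * ppart x - phi (ppart x)) / gp.
Let hazard (x : R) := (mills x)^-1.

Let mills_gt0 x : 0 < mills x.
Proof. by have /andP[] := phi_bound (ppart_ge0 x). Qed.

Let C_gt0 : 0 < C.
Proof. by have /andP[h1 h2] := phi_bound (lexx 0); have := lt_le_trans h1 h2; lra. Qed.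

Let hazard_gt0 x : 0 < hazard x. Proof. by rewrite invr_gt0. Qed.

Let hazard_lb x : 0 <= x -> (C * (1 + x))^-1 <= hazard x.
Proof.
move=> x0; have /andP[m0 mC] := phi_bound x0.
by rewrite /hazard /mills ppart_id // lef_pV2 // posrE (lt_le_trans m0).
Qed.

Let hazard_cont : continuous hazard.
Proof.
move=> x; apply: cvgV; first by rewrite gt_eqF.
apply: cvgM; last exact: cvg_cst.
apply: cvgB; first by apply: cvgM; [exact: cvg_cst|exact: continuous_ppart].
apply: (@continuous_comp _ _ _ ppart phi); first exact: continuous_ppart.
exact: phi_cont.
Qed.

(** Integrating from -1 makes 0 an interior point, so that two-sided derivatives exist there; [surv]
    subtracts the part before 0. *)
Let cumhaz (x : R) := \int[mu]_(t in `[(-1), x]) hazard t.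

Let cumhaz_derive x : -1 < x -> is_derive x 1 cumhaz (hazard x).
Proof.
move=> x1; have xx : x < x + 1 by rewrite ltrDl.
have hI : mu.-integrable `[(-1), x + 1] (EFin \o hazard).
  apply: continuous_compact_integrable; first exact: segment_compact.
  by apply: continuous_in_subspaceT => t _; exact: hazard_cont.
have [d1 d2] := continuous_FTC1_closed xx hI x1 (@hazard_cont x).
exact: (DeriveDef d1 (etrans (esym (derive1E _ _)) d2)).
Qed.

(* The survival function [1 - F] of the distribution with the given hazard rate. *)
Let surv (x : R) := expR (cumhaz 0 - cumhaz x).

Let surv0 : surv 0 = 1. Proof. by rewrite /surv subrr expR0. Qed.

Let surv_gt0 x : 0 < surv x. Proof. exact: expR_gt0. Qed.

Let dens (x : R) := hazard x * surv x.

Let dens_gt0 x : 0 < dens x. Proof. by rewrite mulr_gt0. Qed.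

Let Nsurv_derive x : -1 < x -> is_derive x 1 (fun t => - surv t) (dens x).
Proof.
move=> x1; have dL := cumhaz_derive x1.
have dB : is_derive x 1 (fun t => cumhaz 0 - cumhaz t) (0 - hazard x).
  exact: is_deriveB.
have dS := @is_derive1_comp _ expR (fun t => cumhaz 0 - cumhaz t) x _ _
  (is_derive_expR _) dB.
have := is_deriveN dS; rewrite sub0r mulrN opprK mulrC; exact.
Qed.

Let Nsurv_derivable x : -1 < x -> derivable (fun t => - surv t) x 1.
Proof. by move=> x1; have [] := Nsurv_derive x1. Qed.

Let Nsurv_derive1 x : -1 < x -> derive1 (fun t => - surv t) x = dens x.
Proof. by move=> x1; rewrite derive1E; have [] := Nsurv_derive x1. Qed.

Let Nsurv_cont x : -1 < x -> {for x, continuous (fun t => - surv t)}.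
Proof.
by move=> x1; apply/differentiable_continuous/derivable1_diffP; exact: Nsurv_derivable.
Qed.

Let dens_cont x : -1 < x -> {for x, continuous dens}.
Proof.
move=> x1; apply: cvgM; first exact: hazard_cont.
rewrite (_ : surv = (fun t => - - surv t)).
  by apply: cvgN; exact: Nsurv_cont.
by apply/funext => t; rewrite opprK.
Qed.

Let surv_decr x y : 0 <= x -> x < y -> surv y < surv x.
Proof.
move=> x0 xy; rewrite -ltrN2.
apply: (@gtr0_derive1_incr _ (fun t => - surv t) 0 y _ _ _ x y x0 xy (lexx y)).
- by move=> t; rewrite in_itv /= => /andP[t0 _]; apply: Nsurv_derivable; lra.
- by move=> t; rewrite in_itv /= => /andP[t0 _]; rewrite Nsurv_derive1 //; lra.
- apply: continuous_in_subspaceT => t; rewrite inE /= in_itv /= => /andP[t0 _].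
  by apply: Nsurv_cont; lra.
Qed.

(** The growth bound on the inverse hazard rate integrates to a logarithm. Hence the cumulative
    hazard diverges and no mass escapes to infinity. *)
Let cumhaz_growth x : 0 <= x -> ln (1 + x) / C <= cumhaz x - cumhaz 0.
Proof.
move=> x0; pose K y := cumhaz y - ln (1 + y) / C.
have K_derive y : -1 < y -> is_derive y 1 K (hazard y - (1 + y)^-1 / C).
  move=> y1; have y1' : 0 < 1 + y by lra.
  have dl : is_derive y 1 (fun t : R => 1 + t) 1.
    by have := is_deriveD (is_derive_cst (1 : R) y 1) (is_derive_id y 1); rewrite add0r; exact.
  have dln := @is_derive1_comp _ (@ln R) (fun t => 1 + t) y _ _ (is_derive1_ln y1') dl.
  have dlnC : is_derive y 1 (fun t => ln (1 + t) / C) ((1 + y)^-1 / C).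
    have := is_deriveZ C^-1 dln; rewrite mulr1 /GRing.scale /= mulrC => d.
    rewrite (_ : (fun t : R => ln (1 + t) / C) = C^-1 \*: (@ln R \o +%R 1)).
      exact: d.
    by apply/funext => t /=; rewrite mulrC.
  have dL := cumhaz_derive y1; exact: is_deriveB.
suff : K 0 <= K x by rewrite /K addr0 ln1 mul0r; lra.
apply: (@ger0_derive1_ndecr _ K 0 x _ _ _ 0 x (lexx 0) x0 (lexx x)).
- move=> y; rewrite in_itv /= => /andP[y0 _].
  have y1 : -1 < y by lra.
  by have [] := K_derive y y1.
- move=> y; rewrite in_itv /= => /andP[y0 _].
  have y1 : -1 < y by lra.
  rewrite derive1E; have [_ ->] := K_derive y y1.
  by rewrite subr_ge0 -invfM mulrC; exact/hazard_lb/ltW.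
- apply: derivable_within_continuous => y; rewrite in_itv /= => /andP[y0 _].
  have y1 : -1 < y by lra.
  by have [] := K_derive y y1.
Qed.

Let surv_small e : 0 < e -> exists2 A, 0 <= A & forall x, A <= x -> surv x < e.
Proof.
move=> e0; exists (expR (C * (1 - ln e))); first exact: expR_ge0.
move=> x Ax; have x0 : 0 <= x by apply: le_trans Ax; exact: expR_ge0.
rewrite /surv -[ltRHS](@lnK _ e) ?posrE // ltr_expR.
have := cumhaz_growth x0.
suff : 1 - ln e <= ln (1 + x) / C by lra.
rewrite ler_pdivlMr // mulrC -[leLHS]expRK ler_ln ?posrE ?expR_gt0 //; lra.
Qed.

Let dens_meas : measurable_fun (`[0, +oo[ : set R) dens.
Proof.
apply: subspace_continuous_measurable_fun => //.
apply: continuous_in_subspaceT => t; rewrite inE /= in_itv /= andbT => t0.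
by apply: dens_cont; lra.
Qed.

Let Nsurv_right x : -1 < x -> - surv t @[t --> x^'+] --> - surv x.
Proof. by move=> x1; apply: cvg_at_right_filter; exact: Nsurv_cont. Qed.

Lemma prescribed_density : valuation_density dens.
Proof.
split => //; first by move=> x _; exact: ltW.
rewrite (@ge0_continuous_FTC2y _ dens (fun t => - surv t) 0 0).
- by rewrite surv0 -EFinB opprK add0r.
- by move=> x _; exact: ltW.
- apply: continuous_in_subspaceT => t; rewrite inE /= in_itv /= andbT => t0.
  by apply: dens_cont; lra.
- apply/cvgrPdist_le => e e0; have [A A0 hA] := surv_small e0.
  near=> x; rewrite sub0r opprK ger0_norm ?ltW //; apply: hA.
  by near: x; apply: nbhs_pinfty_ge; exact: num_real.
- by move=> x x0; apply: Nsurv_derivable; lra.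
- by apply: Nsurv_right; lra.
- by move=> x; rewrite in_itv /= andbT => x0; apply: Nsurv_derive1; lra.
Unshelve. all: by end_near. Qed.

Let distE x : 0 <= x -> dist dens x = 1 - surv x.
Proof.
rewrite le_eqVlt => /predU1P[<-|x0].
  by rewrite /dist set_itv1 Rintegral_set1 surv0 subrr.
rewrite /dist /Rintegral (@continuous_FTC2 _ dens (fun t => - surv t)) //=.
- by rewrite surv0 opprK addrC.
- apply: continuous_in_subspaceT => t; rewrite inE /= in_itv /= => /andP[t0 _].
  by apply: dens_cont; lra.
- split.
  + by move=> t; rewrite in_itv /= => /andP[t0 _]; apply: Nsurv_derivable; lra.
  + by apply: Nsurv_right; lra.
  + by apply: cvg_at_left_filter; apply: Nsurv_cont; lra.
- by move=> t; rewrite in_itv /= => /andP[t0 _]; apply: Nsurv_derive1; lra.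
Qed.

Let dist_lt x y : 0 <= x -> x < y -> dist dens x < dist dens y.
Proof.
move=> x0 xy; rewrite !distE //; last by rewrite (le_trans x0) ?ltW.
by rewrite ltrD2l ltrN2; exact: surv_decr.
Qed.

Let dist01 x : 0 <= x -> 0 <= dist dens x < 1.
Proof.
move=> x0; have /andP[-> _] := dist_itv01 prescribed_density x.
by rewrite distE //= ltrBlDl ltrDr.
Qed.

Let dist_surj r : 0 <= r < 1 -> exists2 x, 0 <= x & dist dens x = r.
Proof.
move=> /andP[r0 r1]; have r1' : 0 < 1 - r by lra.
have [A A0 hA] := surv_small r1'.
have cont : {within `[0, A], continuous (fun t => - surv t)}.
  apply: continuous_in_subspaceT => t; rewrite inE /= in_itv /= => /andP[t0 _].
  by apply: Nsurv_cont; lra.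
have sA := hA A (lexx _).
have [|x] := IVT (v := r - 1) A0 cont.
  by rewrite surv0 le_max ge_min; apply/andP; split; apply/orP; [left|right]; lra.
by rewrite in_itv /= => /andP[x0 _] sx; exists x; [exact: x0|rewrite distE; [lra|exact: x0]].
Qed.

Let quantileK x : 0 <= x -> quantile dens (dist dens x) = x.
Proof.
move=> x0; rewrite /quantile; apply/le_anti/andP; split.
  by apply: ge_inf; [exists 0 => y []|split].
apply: lb_le_inf; first by exists x.
move=> y [y0 xy]; rewrite leNgt; apply/negP => yx.
by move: (dist_lt y0 yx); rewrite ltNge xy.
Qed.

Let virtualE x : 0 <= x -> virtual_value gv gp dens x = phi x.
Proof.
move=> x0; rewrite /virtual_value distE // /dens subKr.
have -> : surv x / (hazard x * surv x) = mills x.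
  by rewrite invfM mulrCA divff ?gt_eqF // mulr1 /hazard invrK.
by rewrite /mills ppart_id // [gp * _]mulrC divfK // subKr.
Qed.

Local Notation h := (quantile_virtual gv gp dens).

Let h_dist x : 0 <= x -> h (dist dens x) = phi x.
Proof. by move=> x0; rewrite /quantile_virtual quantileK // virtualE. Qed.

Let dist_inj_le x y : 0 <= x -> 0 <= y -> dist dens x <= dist dens y -> x <= y.
Proof.
by move=> x0 y0; rewrite !leNgt; apply: contra => yx; exact: dist_lt.
Qed.

Let h_le r t : 0 <= r -> r <= t -> t < 1 -> h r <= h t.
Proof.
move=> r0 rt t1; have [x x0 xr] := @dist_surj r ltac:(rewrite r0 (le_lt_trans rt) //).
have [y y0 yt] := @dist_surj t ltac:(rewrite (le_trans r0) //).
rewrite -xr -yt !h_dist //; apply: phi_le; apply: dist_inj_le => //.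
by rewrite xr yt.
Qed.

Let h_lb : exists a, forall r, 0 <= r <= 1 -> a <= h r.
Proof.
exists (phi 0) => r /andP[r0]; rewrite le_eqVlt => /predU1P[->|r1]; last first.
  have [x x0 <-] := @dist_surj r ltac:(rewrite r0 //).
  by rewrite h_dist //; exact: phi_le.
rewrite /quantile_virtual /quantile (_ : [set x | _ /\ _] = set0).
  by rewrite inf0 virtualE.
rewrite -subset0 => x [x0]; rewrite leNgt.
by have /andP[_ ->] := dist01 x0.
Qed.

Let h_cont r : 0 <= r < 1 -> forall e, 0 < e ->
  exists2 d, 0 < d & forall t, 0 <= t < 1 -> `|t - r| < d -> `|h t - h r| <= e.
Proof.
move=> r01 e e0; have [x x0 <-] := dist_surj r01.
have /cvgrPdist_le /(_ e e0) := @phi_cont x.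
rewrite -nbhs_nearE => /nbhs_ballP[b /= b0 hb].
pose b' := b / 2; have b'0 : 0 < b' by rewrite divr_gt0.
pose d1 := dist dens (x + b') - dist dens x.
have d10 : 0 < d1 by rewrite subr_gt0 dist_lt // ltrDl.
pose d2 := if b' <= x then dist dens x - dist dens (x - b') else 1.
have d20 : 0 < d2.
  by rewrite /d2; case: (leP b' x) => // b'x; rewrite subr_gt0 dist_lt ?subr_ge0 // ltrBlDr ltrDl.
exists (Num.min d1 d2); first by rewrite lt_min d10.
move=> t t01; have [y y0 <-] := dist_surj t01.
rewrite lt_min => /andP[t1 t2]; rewrite !h_dist // distrC; apply: hb.
rewrite /ball /= /ball_ /= ltr_norml.
have yx : y < x + b'.
  rewrite ltNge; apply/negP => xy.
  have : dist dens (x + b') <= dist dens y by exact: (dist_le prescribed_density).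
  have := ler_norm (dist dens y - dist dens x).
  by move: t1; rewrite /d1; move: (dist _ _) (dist _ _) (dist _ _) => u w z; lra.
have xy : x - b' < y.
  move: t2; rewrite /d2; case: (leP b' x) => b'x; last by move=> _; rewrite (lt_le_trans _ y0) // subr_lt0.
  move=> t2; rewrite ltNge; apply/negP => yx'.
  have : dist dens y <= dist dens (x - b') by exact: (dist_le prescribed_density).
  have := ler_norm (- (dist dens y - dist dens x)); rewrite normrN.
  by move: t2; move: (dist _ _) (dist _ _) (dist _ _) => u w z; lra.
have bb : b' <= b by rewrite /b'; lra.
by apply/andP; split; lra.
Qed.

Lemma prescribed_virtual_value : exists f, [/\ valuation_density f,
  ironable gv gp f & forall x, 0 <= x -> ironed_virtual_value gv gp f x = (phi x)%:E].
Proof.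
exists dens; split; [exact: prescribed_density|exact: tangent_ironable|].
move=> x x0; rewrite /ironed_virtual_value tangent_ironed_slope ?h_dist //.
exact: dist01.
Qed.

End PrescribedVirtualValue.

Section UniformDensity.
Context {R : realType}.
Variables (gv gp M : R).
Hypothesis M0 : 0 < M.
Local Notation mu := (@lebesgue_measure R).

Definition uniform_density (x : R) : R := M^-1 * \1_(`[0, M] : set R) x.
Local Notation f := uniform_density.

Let fE x : 0 <= x <= M -> f x = M^-1.
Proof. by move=> xM; rewrite /f indicE mem_set ?mulr1 //= in_itv. Qed.

Lemma uniform_valuation_density : valuation_density f.
Proof.
split.
- by apply: measurable_funM; [exact: measurable_cst|exact: measurable_indic].
- by move=> x _; rewrite mulr_ge0 ?invr_ge0 ?(ltW M0) // indicE.
under eq_integral do rewrite EFinM.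
rewrite ge0_integralZl_EFin //; last by rewrite invr_ge0 ltW.
- rewrite integral_indic // (_ : _ `&` _ = `[0, M]%classic).
    have muM : mu `[0, M]%classic = M%:E.
      by rewrite lebesgue_measure_itv /= lte_fin M0 -EFinB subr0.
    rewrite [X in (_ * X)%E](_ : _ = M%:E); last exact: muM.
    by rewrite -EFinM mulVf ?gt_eqF.
  apply/seteqP; split=> x /=; rewrite !in_itv /= andbT; first by case.
  by move=> xM; split=> //; case/andP: xM.
- by apply/measurable_EFinP; exact: measurable_indic.
Qed.

Lemma uniform_dist x : 0 <= x <= M -> dist f x = x / M.
Proof.
move=> /andP[x0 xM]; rewrite /dist.
rewrite (@eq_Rintegral _ _ _ mu _ (fun=> M^-1)) ?Rintegral_cst0a //.
move=> t; rewrite inE /= in_itv /= => /andP[t0 tx].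
by rewrite fE // t0 (le_trans tx).
Qed.

Let quantileE r : 0 <= r <= 1 -> quantile f r = M * r.
Proof.
move=> /andP[r0 r1]; have Mr : 0 <= M * r <= M.
  by rewrite mulr_ge0 ?(ltW M0) //= ler_piMr // ltW.
have Mr0 : 0 <= M * r by case/andP: Mr.
have dMr : dist f (M * r) = r by rewrite uniform_dist // mulrAC divff ?mul1r // gt_eqF.
rewrite /quantile; apply/le_anti/andP; split.
  by apply: ge_inf; [exists 0 => y []|split; rewrite ?dMr].
apply: lb_le_inf; first by exists (M * r); split; rewrite ?dMr.
move=> y [y0 ry]; rewrite leNgt; apply/negP => yMr.
move: ry; rewrite uniform_dist; last first.
  by rewrite y0 (le_trans (ltW yMr)) //; case/andP: Mr.
by rewrite ler_pdivlMr // mulrC leNgt yMr.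
Qed.

Local Notation h := (quantile_virtual gv gp f).

Let hE r : 0 <= r <= 1 -> h r = M * ((gv + gp) * r - gp * (1 - r)).
Proof.
move=> r01; have /andP[r0 r1] := r01.
have Mr : 0 <= M * r <= M by rewrite mulr_ge0 ?(ltW M0) //= ler_piMr // ltW.
rewrite /quantile_virtual quantileE // /virtual_value uniform_dist // fE // invrK.
by field; rewrite gt_eqF.
Qed.

Section Convex.
Hypothesis convex_case : 0 <= gv + 2 * gp.

Let h_le r t : 0 <= r -> r <= t -> t < 1 -> h r <= h t.
Proof.
move=> r0 rt t1; have r01 : 0 <= r <= 1 by lra.
have t01 : 0 <= t <= 1 by lra.
rewrite !hE // ler_pM2l //; have := ler_wpM2l convex_case rt; lra.
Qed.

Let h_lb : exists a, forall r, 0 <= r <= 1 -> a <= h r.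
Proof.
exists (- M * gp) => r r01; rewrite hE // mulNr -mulrN ler_pM2l //.
have /andP[r0 _] := r01; have := mulr_ge0 convex_case r0; lra.
Qed.

Let h_cont r : 0 <= r < 1 -> forall e, 0 < e ->
  exists2 d, 0 < d & forall t, 0 <= t < 1 -> `|t - r| < d -> `|h t - h r| <= e.
Proof.
move=> /andP[r0 r1] e e0; pose K := M * (gv + 2 * gp).
have K0 : 0 <= K by rewrite mulr_ge0 // ltW.
have K10 : 0 < K + 1 by rewrite ltr_wpDl.
exists (e / (K + 1)); first exact: divr_gt0.
move=> t /andP[t0 t1]; rewrite ltr_pdivlMr // => te.
have r01 : 0 <= r <= 1 by lra.
have t01 : 0 <= t <= 1 by lra.
rewrite !hE //.
rewrite (_ : _ - _ = K * (t - r)); last by rewrite /K; ring.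
rewrite normrM ger0_norm //; have := normr_ge0 (t - r); lra.
Qed.

Lemma uniform_convex_ironable : ironable gv gp f.
Proof. exact: tangent_ironable. Qed.

Lemma uniform_convex_virtual x : 0 <= x < M ->
  ironed_virtual_value gv gp f x = ((gv + gp) * x - gp * (M - x))%:E.
Proof.
move=> /andP[x0 xM]; have xM1 : 0 <= x / M < 1.
  by rewrite divr_ge0 ?(ltW M0) //= ltr_pdivrMr // mul1r.
rewrite /ironed_virtual_value uniform_dist ?x0 ?ltW // tangent_ironed_slope //.
have /andP[y0 y1] := xM1; rewrite hE ?y0 ?ltW //.
by congr EFin; field; rewrite gt_eqF.
Qed.

End Convex.

Section Concave.
Hypothesis concave_case : gv + 2 * gp <= 0.

Let F (q : R) := M * ((gv + 2 * gp) / 2 * (q * q) - gp * q).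

Let cumulE q : 0 <= q <= 1 -> cumulative_virtual gv gp f q = (F q)%:E.
Proof.
move=> /andP[q0 q1]; rewrite /cumulative_virtual.
move: q0; rewrite le_eqVlt => /predU1P[<-|q0].
  by rewrite set_itv1 integral_set1 /F; congr EFin; ring.
pose g (r : R) := M * ((gv + 2 * gp) * r - gp).
have dF (t : R) : is_derive t 1 F (g t).
  have dq := is_deriveM (is_derive_id t 1) (is_derive_id t 1).
  have d1 := is_deriveZ ((gv + 2 * gp) / 2) dq.
  have d2 := is_deriveZ gp (is_derive_id t 1).
  have d3 := is_deriveZ M (is_deriveB d1 d2).
  apply: (is_derive_eq d3); rewrite /GRing.scale /= /g.
  by field.
have gc : continuous g.
  move=> t; apply: cvgM; first exact: cvg_cst.
  apply: cvgB; last exact: cvg_cst.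
  by apply: cvgM; [exact: cvg_cst|exact: cvg_id].
have Fc t : {for t, continuous F}.
  by apply/differentiable_continuous/derivable1_diffP; have [] := dF t.
transitivity (\int[mu]_(r in `[0%R, q]) (g r)%:E)%E.
  apply: eq_integral => r; rewrite inE /= in_itv /= => /andP[r0 rq].
  by rewrite hE ?r0 ?(le_trans rq) //; congr EFin; rewrite /g; ring.
rewrite (@continuous_FTC2 _ g F) //.
- by rewrite -EFinB; congr EFin; rewrite /F; ring.
- by apply: continuous_in_subspaceT => t _; exact: gc.
- split.
  + by move=> t _; have [] := dF t.
  + by apply: cvg_at_right_filter; exact: Fc.
  + by apply: cvg_at_left_filter; exact: Fc.
- by move=> t _; rewrite derive1E; have [] := dF t.
Qed.

Lemma uniform_concave_ironable : ironable gv gp f.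
Proof.
split=> [q /andP[q0 q1]|]; first by rewrite cumulE ?q0 ?ltW.
by rewrite cumulE ?ler01 ?lexx // ltNyr.
Qed.

(* The cumulative virtual value is concave, so that ironing replaces it by its
   chord. *)
Let ironedE q : 0 <= q < 1 -> ironed_cumulative gv gp f q = M * (gv / 2) * q.
Proof.
move=> q01; have /andP[q0 q1] := q01.
have F1 : F 1 = M * (gv / 2) by rewrite /F; field.
have chord : convex_minorant gv gp f (fun r => 0 + M * (gv / 2) * r).
  apply: affine_minorant => r r01; rewrite cumulE // lee_fin add0r /F -mulrA ler_pM2l //.
  have /andP[r0 r1] := r01.
  have : 0 <= r * (1 - r) by rewrite mulr_ge0 // subr_ge0.
  by move=> rr; have := ler_wnM2l concave_case rr; lra.
apply/le_anti/andP; split; last first.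
  by have := ironed_ub uniform_concave_ironable chord q01; rewrite add0r.
apply: ironed_le => [|phi mphi]; first by eexists; exact: chord.
have i00 : 0 <= (0 : R) <= 1 by rewrite lexx ler01.
have i11 : 0 <= (1 : R) <= 1 by rewrite lexx ler01.
have q01' : 0 <= q <= 1 by rewrite q0 ltW.
have := convex_minorant01 mphi i11 i00 q01'.
rewrite mulr1 mulr0 addr0 => /le_trans; apply.
have [_ phi_le] := mphi.
have := phi_le 0 i00; rewrite cumulE // lee_fin => phi0.
have := phi_le 1 i11; rewrite cumulE // lee_fin F1 => phi1.
have F00 : F 0 = 0 by rewrite /F; ring.
rewrite F00 in phi0.
have := ler_wpM2l q0 phi1; have q1' : 0 <= 1 - q by lra.
have := ler_wpM2l q1' phi0; lra.
Qed.

Lemma uniform_concave_virtual x : 0 <= x < M ->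
  ironed_virtual_value gv gp f x = (M * (gv / 2))%:E.
Proof.
move=> /andP[x0 xM]; rewrite /ironed_virtual_value uniform_dist ?x0 ?ltW //.
have xM1 : 0 <= x / M < 1.
  by rewrite divr_ge0 ?(ltW M0) //= ltr_pdivrMr // mul1r.
apply: (@ironed_slope_eq _ _ _ _ _ _ (fun=> M * (gv / 2)) uniform_concave_ironable xM1).
  move=> r /andP[xr r1]; have r0 : 0 < r by case/andP: xM1 => y0 _; exact: le_lt_trans xr.
  apply: derivable_eps => e e0; exists (Num.min r (1 - r)).
    by rewrite lt_min r0 subr_gt0.
  move=> t; rewrite lt_min => /andP[tr t1].
  have rt01 : 0 <= r + t < 1.
    by have := ler_norm t; have := ler_norm (- t); rewrite normrN; lra.
  rewrite !ironedE ?rt01 ?(ltW r0) //.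
  rewrite (_ : _ - _ - _ = 0); last by ring.
  by rewrite normr0 mulr_ge0 // ltW.
by move=> e e0; exists 1 => // r _ _ _; rewrite subrr normr0 ltW.
Qed.

End Concave.

Lemma negative_virtual_value : gv < 0 -> gp < 0 \/ gv + gp <= 0 ->
  exists g, [/\ valuation_density g, ironable gv gp g &
    forall x, 0 <= x < M -> (ironed_virtual_value gv gp g x < 0)%E].
Proof.
move=> gv0 gvp; exists f; have [conc|conv] := leP (gv + 2 * gp) 0.
  split; [exact: uniform_valuation_density|exact: uniform_concave_ironable|].
  move=> x xM; rewrite uniform_concave_virtual // lte_fin.
  by rewrite pmulr_rlt0 //; lra.
split; [exact: uniform_valuation_density|exact/uniform_convex_ironable/ltW|].
move=> x xM; rewrite (uniform_convex_virtual (ltW conv) xM) lte_fin.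
have /andP[x0 xM'] := xM.
have gp_gt0 : 0 < gp by case: gvp; lra.
have gvp0 : gv + gp <= 0 by case: gvp; lra.
have : (gv + gp) * x <= 0 by rewrite mulr_le0_ge0.
have : 0 < gp * (M - x) by rewrite mulr_gt0 // subr_gt0.
lra.
Qed.

End UniformDensity.

(** * Realizing lotteries *)

Section Ramp.
Context {R : realType}.
Implicit Types a d x y : R.

Definition ramp a d x : R := (ppart (x - a) - ppart (x - a - d)) / d.

Lemma ramp_le a d x : 0 < d -> x <= a -> ramp a d x = 0.
Proof.
move=> d0 xa; have h1 : x - a <= 0 by lra.
have h2 : x - a - d <= 0 by lra.
by rewrite /ramp !ppart_eq0 // subrr mul0r.
Qed.

Lemma ramp_ge a d x : 0 < d -> a + d <= x -> ramp a d x = 1.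
Proof.
move=> d0 xa; have h1 : 0 <= x - a by lra.
have h2 : 0 <= x - a - d by lra.
by rewrite /ramp !ppart_id // subKr divff // gt_eqF.
Qed.

Lemma ramp_mid a d x : 0 < d -> a <= x <= a + d -> ramp a d x = (x - a) / d.
Proof.
move=> d0 xad; have h1 : 0 <= x - a by lra.
have h2 : x - a - d <= 0 by lra.
by rewrite /ramp ppart_id // ppart_eq0 // subr0.
Qed.

Lemma ramp_itv01 a d x : 0 < d -> 0 <= ramp a d x <= 1.
Proof.
move=> d0; have [xa|ax] := leP x a; first by rewrite ramp_le // lexx ler01.
have [xd|dx] := leP (a + d) x; first by rewrite ramp_ge // lexx ler01.
have xad : a <= x <= a + d by lra.
have xa0 : 0 <= x - a by lra.
rewrite ramp_mid // divr_ge0 // ?(ltW d0) //= ler_pdivrMr // mul1r; lra.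
Qed.

Lemma ramp_mono a d x y : 0 < d -> x <= y -> ramp a d x <= ramp a d y.
Proof.
move=> d0 xy; have /andP[y0 y1] := ramp_itv01 a y d0; have /andP[x0 x1] := ramp_itv01 a x d0.
have [xa|ax] := leP x a; first by rewrite [leLHS]ramp_le.
have [yd|dy] := leP (a + d) y; first by rewrite [leRHS]ramp_ge.
rewrite !ramp_mid // ?ler_pM2r ?invr_gt0 //; lra.
Qed.

Lemma continuous_ramp a d : continuous (ramp a d).
Proof.
have shift_cont b : continuous (fun x : R => ppart (x - b)).
  move=> x; apply: (@continuous_comp _ _ _ (fun x => x - b) (@ppart R)).
    by apply: cvgB; [exact: cvg_id|exact: cvg_cst].
  exact: continuous_ppart.
move=> x; apply: cvgM; last exact: cvg_cst.
apply: cvgB; first exact: shift_cont.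
rewrite (_ : (fun t : R => ppart (t - a - d)) = (fun t => ppart (t - (a + d)))).
  by rewrite -addrA -opprD; exact: shift_cont.
by apply/funext => t; rewrite -addrA -opprD.
Qed.

End Ramp.

Section LowerBound.
Context {R : realType} {n : nat}.
Variables (gv gp : R) (k : nat) (v : 'I_n -> R) (M : R).
Local Notation mu := (@lebesgue_measure R).
Local Notation perf := (performance gv gp).
Hypothesis vM : forall i, 0 <= v i <= M.

Let v0 i : 0 <= v i. Proof. by have /andP[] := vM i. Qed.

Lemma highest_score_ext (w : R -> \bar R) (u u' : 'I_n -> R) i :
  (forall j, w (u j) = w (u' j)) -> highest_score k w u i = highest_score k w u' i.
Proof.
move=> ww; rewrite /highest_score ww.
have -> : [set j | w (u j) == w (u' i)]%SET = [set j | w (u' j) == w (u' i)]%SET.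
  by apply/setP => j; rewrite !inE ww.
have -> : [set j | (w (u' i) < w (u j))%E]%SET = [set j | (w (u' i) < w (u' j))%E]%SET.
  by apply/setP => j; rewrite !inE ww.
by [].
Qed.

Lemma lottery_ext (X Y X' Y' : R -> bool) (u : 'I_n -> R) i :
  (forall j, X (u j) = X' (u j)) -> (forall j, Y (u j) = Y' (u j)) ->
  lottery k X Y u i = lottery k X' Y' u i.
Proof.
move=> XX YY; rewrite /lottery.
have -> : [set j | X (u j)]%SET = [set j | X' (u j)]%SET.
  by apply/setP => j; rewrite !inE XX.
have -> : [set j | ~~ X (u j) && Y (u j)]%SET = [set j | ~~ X' (u j) && Y' (u j)]%SET.
  by apply/setP => j; rewrite !inE XX YY.
by [].
Qed.

Section Levels.
Variables (p q L0 L1 L2 : R) (w : R -> \bar R) (E : set R) (eps : R).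
Hypotheses (q0 : 0 <= q) (qp : q <= p) (L01 : L0 < L1) (L12 : L1 < L2) (L1_ge0 : 0 <= L1).
Hypothesis w_le : forall x y, 0 <= x -> x <= y -> (w x <= w y)%E.
Hypothesis mE : measurable E.
Hypothesis muE : (mu E <= eps%:E)%E.
Hypothesis vE : forall j, ~ E (v j).
Hypothesis wE : forall z, 0 <= z <= M -> ~ E z ->
  w z = (if p < z then L2 else if q < z then L1 else L0)%:E.
Hypothesis signs : (L0 < 0 /\ 0 < gp) \/ [/\ 0 <= L0, gp < 0 & 0 <= gv].

Let x : @allocation R n := highest_score k w.
Let y : @allocation R n := lottery k (fun z => p < z) (fun z => q < z).

Let up_lt (a : R) : upward (fun z => a < z).
Proof. by move=> z z' _ zz' /lt_le_trans; apply. Qed.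

Let my i : monotone_at y v i. Proof. by apply: lottery_monotone; exact: up_lt. Qed.

Let y01 i z : 0 <= y [eta v with i |-> z] i <= 1. Proof. exact: lottery_itv01. Qed.

Let mx i : monotone_at x v i.
Proof.
have [X [Y [upX upY _ xE]]] := highest_score_lottery k v0 w_le.
move=> z z' z0 zz' zv; rewrite /x !xE ?z0 ?(le_trans zz') ?(le_trans z0) //.
exact: lottery_monotone.
Qed.

Let x01 i z : 0 <= z <= v i -> 0 <= x [eta v with i |-> z] i <= 1.
Proof.
have [X [Y [_ _ _ xE]]] := highest_score_lottery k v0 w_le.
by move=> zv; rewrite /x xE //; exact: lottery_itv01.
Qed.

Let levels (u : 'I_n -> R) i : (forall j, 0 <= u j <= M /\ ~ E (u j)) -> q < u i ->
  highest_score k w u i = y u i.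
Proof.
move=> uE qu.
have wu j : w (u j) = (if p < u j then L2 else if q < u j then L1 else L0)%:E.
  by have [uj Euj] := uE j; exact: wE.
have L2_ge0 : 0 <= L2 by rewrite (le_trans L1_ge0) ?ltW.
have L02 : L0 < L2 := lt_trans L01 L12.
rewrite /y /highest_score /lottery !inE wu qu andbT; have [pu|up] := ltP p (u i).
  rewrite lee_fin L2_ge0; congr (uniform_serve _ _ _).
    apply/setP => j; rewrite !inE wu eqe; case: ifP => _; first by rewrite eqxx.
    by case: ifP => _; apply/negbTE; rewrite lt_eqF.
  rewrite (_ : [set j | _]%SET = finset.set0) ?cards0 ?subn0 //.
  apply/setP => j; rewrite !inE wu lte_fin; case: ifP => _; first by rewrite ltxx.
  by case: ifP => _; apply/negbTE; rewrite -leNgt ltW.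
rewrite lee_fin L1_ge0 /=.
have -> : [set j | w (u j) == L1%:E]%SET = [set j | ~~ (p < u j) && (q < u j)]%SET.
  apply/setP => j; rewrite !inE wu eqe; case: ifP => _ /=.
    by apply/negbTE; rewrite gt_eqF.
  by case: ifP => _; [rewrite eqxx|apply/negbTE; rewrite lt_eqF].
have -> // : [set j | (L1%:E < w (u j))%E]%SET = [set j | p < u j]%SET.
apply/setP => j; rewrite !inE wu lte_fin; case: ifP => _; first by rewrite L12.
by case: ifP => _; [rewrite ltxx|apply/negbTE; rewrite -leNgt ltW].
Qed.

Let updE i z : 0 <= z <= v i -> ~ E z -> forall j,
  0 <= [eta v with i |-> z] j <= M /\ ~ E ([eta v with i |-> z] j).
Proof.
move=> /andP[z0 zv] Ez j /=; case: eqP => _; last by split.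
by split=> //; rewrite z0 (le_trans zv) //; have /andP[] := vM i.
Qed.

Let xyE i z : 0 <= z <= v i -> ~ E z -> q < z ->
  x [eta v with i |-> z] i = y [eta v with i |-> z] i.
Proof. by move=> zv Ez qz; apply: levels; [exact: updE|rewrite /= eqxx]. Qed.

Let y_low i z : z <= q -> y [eta v with i |-> z] i = 0.
Proof.
by move=> zq; rewrite /y lottery_update !ltNge zq (le_trans zq qp).
Qed.

Lemma levels_performance : perf y v <= perf x v + n%:R * (`|gp| * eps).
Proof.
have vi i : 0 <= v i <= v i by rewrite v0 lexx.
case: signs => [[L0neg gp_gt0]|[L0_ge0 gp_lt0 gv_ge0]].
  have x_low i z : 0 <= z <= v i -> ~ E z -> z <= q -> x [eta v with i |-> z] i = 0.
    move=> zv Ez zq; have [zM _] := updE zv Ez i; move: zM; rewrite /= eqxx => zM.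
    rewrite /x /highest_score /= eqxx wE // !ltNge zq (le_trans zq qp) /=.
    by rewrite lee_fin leNgt L0neg.
  have xy i z : 0 <= z <= v i -> ~ E z ->
      y [eta v with i |-> z] i = x [eta v with i |-> z] i.
    move=> zv Ez; have [zq|qz] := leP z q; first by rewrite y_low // x_low.
    by rewrite xyE.
  apply: (performance_close _ _ v0 my mx mE muE).
  - by move=> i; rewrite -[in LHS](update_id v i) -[in RHS](update_id v i); exact: xy.
  - by move=> i z _; exact: y01.
  - exact: x01.
  - exact: xy.
apply: performance_le => i.
have yx : y v i <= x v i.
  have [zq|qz] := leP (v i) q.
    by rewrite -[y v]/(y v) -(update_id v i) y_low //; have /andP[] := x01 (vi i).
  by rewrite -(update_id v i) xyE.
have pay : payment x v i <= payment y v i + eps.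
  apply: (payment_le (v0 i) (@mx i) (@my i) mE muE) => z zv.
  have /andP[z0 zvi] := zv; have /andP[xz0 xz1] := x01 zv.
  have /andP[yz0 yz1] := y01 i z.
  have /andP[xv0 xv1] := x01 (vi i); rewrite update_id in xv0 xv1.
  rewrite indicE; have [Ez|Ez] := pselect (E z).
    rewrite mem_set //; have [vq|qv] := leP (v i) q.
      rewrite (y_low i (le_trans zvi vq)) -[in y v i](update_id v i) y_low //.
      by move: xz0 xv1; rewrite /=; lra.
    have -> : x v i = y v i.
      by rewrite -(update_id v i) xyE.
    by move: xz0 yz1; rewrite /=; lra.
  rewrite memNset // addr0; have [vq|qv] := leP (v i) q.
    rewrite (y_low i (le_trans zvi vq)) -[in y v i](update_id v i) y_low //.
    rewrite subr0 subr_le0 -{1}(update_id v i) /x (@highest_score_ext w _ [eta v with i |-> z]) //.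
    move=> j /=; case: eqP => // _.
    have zM : 0 <= z <= M by rewrite z0 (le_trans zvi) //; have /andP[] := vM i.
    by rewrite !wE // !ltNge vq (le_trans vq qp) (le_trans zvi vq) (le_trans (le_trans zvi vq) qp).
  have -> : x v i = y v i by rewrite -(update_id v i) xyE.
  rewrite lerD2l lerN2; have [zq|qz] := leP z q; first by rewrite y_low.
  by rewrite xyE.
have h1 : gv * (v i * y v i) <= gv * (v i * x v i) by rewrite !ler_wpM2l.
have h2 : gp * (payment y v i + eps) <= gp * payment x v i.
  by rewrite ler_wnM2l // ltW.
rewrite ltr0_norm // mulNr; move: h1 h2; rewrite mulrDr.
move: (gv * (v i * y v i)) (gv * (v i * x v i)) (gp * payment x v i)
  (gp * payment y v i) (gp * eps) => a b c d e; lra.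
Qed.

End Levels.
End LowerBound.

Section Achievability.
Context {R : realType} {n : nat}.
Variables (gv gp : R) (k : nat) (v : 'I_n -> R).
Local Notation mu := (@lebesgue_measure R).
Local Notation perf := (performance gv gp).
Hypothesis gp0 : gp != 0.
Hypothesis v0 : forall i, 0 <= v i.

Lemma exists_gap (a t : R) : 0 < t -> exists2 d, 0 < d <= t & forall j, a < v j -> a + 3 * d < v j.
Proof.
move=> t0.
suff [d dt hd] : exists2 d, 0 < d <= t &
    forall j, j \in enum 'I_n -> a < v j -> a + 3 * d < v j.
  by exists d => // j; apply: hd; rewrite mem_enum.
elim: (enum 'I_n) => [|i s [d /andP[d0 dt] hd]]; first by exists t; rewrite ?t0 ?lexx.
have [avi|via] := ltP a (v i); last first.
  exists d; first by rewrite d0.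
  move=> j; rewrite inE => /predU1P[->|/hd//]; by rewrite ltNge via.
have e0 : 0 < (v i - a) / 4 by lra.
exists (Num.min d ((v i - a) / 4)); first by rewrite lt_min d0 e0 ge_min dt.
have md : Num.min d ((v i - a) / 4) <= d by rewrite ge_min lexx.
have me : Num.min d ((v i - a) / 4) <= (v i - a) / 4 by rewrite ge_min lexx orbT.
move: (Num.min _ _) md me => m md me j; rewrite inE => /predU1P[->|js] aj; first by lra.
by have := hd j js aj; lra.
Qed.

Let M := 1 + \sum_i v i.

Let vM i : 0 <= v i < M.
Proof.
rewrite v0 /M (bigD1 i) //=.
have : 0 <= \sum_(j | j != i) v j by apply: sumr_ge0.
by move: (\sum_(j | _) _) => S; lra.
Qed.

Let vMle i : 0 <= v i <= M. Proof. by have /andP[-> /ltW] := vM i. Qed.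

Let M_gt0 : 0 < M. Proof. by rewrite /M ltr_wpDr // sumr_ge0. Qed.

Lemma finite_thresholds (p q : \bar R) : (0 <= q <= p)%E ->
  exists p' q' : R, [/\ 0 <= q' & q' <= p'] /\
    perf (two_level_lottery k p q) v =
    perf (lottery k (fun z => p' < z) (fun z => q' < z)) v.
Proof.
pose clip (a : \bar R) : R := match a with r%:E => Num.min r M | +oo%E => M | _ => 0 end.
have clipE (a : \bar R) z : (0 <= a)%E -> z <= M -> (a < z%:E)%E = (clip a < z).
  case: a => [r|//|//] _ zM /=; last by rewrite ltNge leey ltNge zM.
  by rewrite lte_fin gt_min [M < z]ltNge zM orbF.
move=> /andP[q0 qp]; have p0 : (0 <= p)%E by exact: le_trans qp.
exists (clip p), (clip q); split.
  split.
    by case: q q0 {qp} => [r|//|//] /=; rewrite ?lee_fin ?le_min ?(ltW M_gt0) ?andbT.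
  case: q q0 qp => [r'| |] // _; case: p p0 => [r| |] //= _; rewrite ?lee_fin //.
    by move=> rr; rewrite le_min !ge_min rr lexx orbT.
  by move=> _; rewrite ge_min lexx orbT.
rewrite two_level_lotteryE; apply: performance_ext => // i z /andP[z0 zv].
have uM j : [eta v with i |-> z] j <= M.
  by rewrite /=; case: eqP => _; [apply: le_trans zv _|]; have /andP[] := vMle i;
    have /andP[] := vMle j.
by apply: lottery_ext => j; apply: clipE.
Qed.

Section TargetLevels.
Variables (p q d c0 c1 c2 e C : R).
Hypotheses (q0 : 0 <= q) (qp : q <= p) (d0 : 0 < d).
Hypotheses (pgap : forall j, p < v j -> p + 3 * d < v j).
Hypotheses (qgap : forall j, q < v j -> q + 3 * d < v j).
Hypotheses (c1_gt0 : 0 < c1) (c2_gt0 : 0 < c2) (c01 : 0 <= c0 + c1) (e_ge0 : 0 <= e).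
Hypothesis signs : (c0 < 0 /\ 0 < gp) \/ [/\ 0 <= c0, gp < 0 & 0 <= gv].

(* A continuous version of the score with values [c0], [c0 + c1], [c0 + c1 + c2]
   on [0, q], (q, p], (p, M]; beyond [M] no value occurs, and the last term keeps
   the inverse hazard rate of [target_bound] positive. *)
Definition target (x : R) : R :=
  c0 + c1 * ramp (q + d) d x + c2 * ramp (p + 2 * d) d x + e * ppart (x - M).

Hypothesis target_bound : forall x, 0 <= x ->
  0 < ((gv + gp) * x - target x) / gp <= C * (1 + x).

Let target_le x y : x <= y -> target x <= target y.
Proof.
move=> xy; rewrite /target.
have r1 := ler_wpM2l (ltW c1_gt0) (ramp_mono (q + d) d0 xy).
have r2 := ler_wpM2l (ltW c2_gt0) (ramp_mono (p + 2 * d) d0 xy).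
have r3 : e * ppart (x - M) <= e * ppart (y - M).
  apply: ler_wpM2l => //; have [xM|Mx] := leP x M.
    by rewrite ppart_eq0 ?subr_le0 // ppart_ge0.
  by rewrite !ppart_id ?lerD2r // subr_ge0 ltW // (lt_le_trans Mx).
by rewrite !lerD.
Qed.

Let target_cont : continuous target.
Proof.
have mul_cont (a : R) (h : R -> R) : continuous h -> continuous (fun x => a * h x).
  by move=> hc x; apply: cvgM; [exact: cvg_cst|exact: hc].
have shift_cont : continuous (fun t : R => ppart (t - M)).
  move=> t; apply: (@continuous_comp _ _ _ (fun x => x - M) (@ppart R)).
    by apply: cvgB; [exact: cvg_id|exact: cvg_cst].
  exact: continuous_ppart.
move=> x; apply: cvgD; last exact: (mul_cont e _ shift_cont x).
apply: cvgD; last exact: (mul_cont c2 _ (@continuous_ramp R _ _) x).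
apply: cvgD; first exact: cvg_cst.
exact: (mul_cont c1 _ (@continuous_ramp R _ _) x).
Qed.

Lemma target_performance :
  ((perf (lottery k (fun z => (p < z)%R) (fun z => (q < z)%R)) v)%:E <=
   benchmark gv gp k v + (n%:R * (`|gp| * (6 * d)))%:E)%E.
Proof.
have [f [densf ironf fE]] := prescribed_virtual_value gp0 target_cont target_le target_bound.
pose E : set R := `]p, p + 3 * d] `|` `]q, q + 3 * d].
have d3 : 0 <= 3 * d by rewrite mulr_ge0 // ltW.
have muE : (mu E <= (6 * d)%:E)%E.
  have -> : 6 * d = 3 * d + 3 * d by ring.
  by rewrite EFinD; apply: lebesgue_measureU_le => //; exact: lebesgue_measure_oc_le.
have EP (z : R) : ~ E z -> (p < z -> p + 3 * d < z) /\ (q < z -> q + 3 * d < z).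
  move=> /not_orP[/=]; rewrite !in_itv /= => /negP pz /negP qz.
  by split => lt; rewrite ltNge; [apply: contra pz|apply: contra qz] => le; rewrite lt.
have vE j : ~ E (v j).
  case=> /=; rewrite in_itv /= => /andP[h1]; rewrite leNgt.
    by rewrite pgap.
  by rewrite qgap.
have past1 (z : R) : q + 3 * d < z -> q + d + d <= z by lra.
have past2 (z : R) : p + 3 * d < z -> p + 2 * d + d <= z by lra.
have before1 (z : R) : z <= q -> z <= q + d by lra.
have before2 (z : R) : z <= p -> z <= p + 2 * d by lra.
have wE (z : R) : 0 <= z <= M -> ~ E z -> ironed_virtual_value gv gp f z =
    (if p < z then c0 + c1 + c2 else if q < z then c0 + c1 else c0)%:E.
  move=> /andP[z0 zM] /EP[pz qz]; rewrite fE //; congr EFin.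
  rewrite /target [ppart _]ppart_eq0 ?subr_le0 // mulr0 addr0.
  have [/pz pz'|zp] := ltP p z.
    by rewrite !ramp_ge ?past1 ?past2 ?(le_lt_trans _ pz') ?lerD2r // !mulr1.
  have [/qz qz'|zq] := ltP q z.
    rewrite (ramp_ge (a := q + d)) ?past1 // (ramp_le (a := p + 2 * d)) ?before2 //.
    by rewrite mulr0 mulr1 addr0.
  rewrite (ramp_le (a := q + d)) ?before1 // (ramp_le (a := p + 2 * d)) ?before2 ?(le_trans zq) //.
  by rewrite !mulr0 !addr0.
have w_le (x y : R) : 0 <= x -> x <= y ->
    (ironed_virtual_value gv gp f x <= ironed_virtual_value gv gp f y)%E.
  by move=> _; exact: ironed_virtual_value_le.
have L01 : c0 < c0 + c1 by rewrite ltrDl.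
have L12 : c0 + c1 < c0 + c1 + c2 by rewrite ltrDl.
have mE : measurable E by apply: measurableU.
have := levels_performance k vMle qp L01 L12 c01 w_le mE muE vE wE signs.
rewrite -lee_fin EFinD => /le_trans; apply.
apply: leeD; last exact: lexx.
by apply: ereal_sup_ubound; exists f.
Qed.

End TargetLevels.

Lemma lottery_le_benchmark (p q : R) : 0 <= q -> q <= p ->
  ((perf (lottery k (fun z => (p < z)%R) (fun z => (q < z)%R)) v)%:E <=
   benchmark gv gp k v)%E.
Proof.
move=> q0 qp.
have reject : gv < 0 -> gp < 0 \/ gv + gp <= 0 ->
    ((perf (lottery k (fun z => (p < z)%R) (fun z => (q < z)%R)) v)%:E <=
     benchmark gv gp k v)%E.
  move=> gv0 gvp.
  have [f [densf ironf f_lt0]] := negative_virtual_value M_gt0 gv0 gvp.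
  have up_lt (a : R) : upward (fun z => a < z).
    by move=> z z' _ zz' /lt_le_trans; apply.
  apply: (@le_trans _ _ (perf (opt_mechanism gv gp f k) v)%:E); last first.
    by apply: ereal_sup_ubound; exists f.
  rewrite lee_fin (@performance0 _ _ _ _ (opt_mechanism gv gp f k)) //.
    apply: performance_le0 => //; last by case: gvp => h; [left; exact: ltW|right].
    - by move=> i; apply: lottery_monotone; exact: up_lt.
    - by move=> i z _; have /andP[] := lottery_itv01 k (fun z => p < z) (fun z => q < z)
        [eta v with i |-> z] i.
    - exact: ltW.
  move=> i z /andP[z0 zv]; rewrite /opt_mechanism /highest_score /= eqxx.
  have /andP[_ vi] := vM i.
  by rewrite leNgt f_lt0 // z0 (le_lt_trans zv).
apply/lee_addgt0Pr => eps eps0.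
pose c : R := n%:R * (`|gp| * 6) + 1.
have c_gt0 : 0 < c by rewrite ltr_wpDl // !mulr_ge0.
have t0 : 0 < eps / c by rewrite divr_gt0.
have [d1 /andP[d10 d1t] pgap] := exists_gap p t0.
have [d /andP[d0 dd1] qgap] := exists_gap q d10.
have pgap' j : p < v j -> p + 3 * d < v j by move=> /pgap; lra.
have small : n%:R * (`|gp| * (6 * d)) <= eps.
  have -> : n%:R * (`|gp| * (6 * d)) = (n%:R * (`|gp| * 6)) * d by ring.
  have dt : d <= eps / c := le_trans dd1 d1t.
  rewrite ler_pdivlMr // in dt; apply: le_trans dt; rewrite mulrC ler_wpM2l ?(ltW d0) //.
  by rewrite /c lerDl.
suff : ((perf (lottery k (fun z => (p < z)%R) (fun z => (q < z)%R)) v)%:E <=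
    benchmark gv gp k v + (n%:R * (`|gp| * (6 * d)))%:E)%E.
  by move=> /le_trans; apply; apply: leeD; [exact: lexx|rewrite lee_fin].
have weaken : ((perf (lottery k (fun z => (p < z)%R) (fun z => (q < z)%R)) v)%:E <=
    benchmark gv gp k v)%E ->
    ((perf (lottery k (fun z => (p < z)%R) (fun z => (q < z)%R)) v)%:E <=
    benchmark gv gp k v + (n%:R * (`|gp| * (6 * d)))%:E)%E.
  move=> /le_trans; apply; rewrite -[leLHS]adde0; apply: leeD; first exact: lexx.
  by rewrite lee_fin !mulr_ge0 // ltW.
have r01 a x := ramp_itv01 a x d0.
have /orP[gp_lt0|gp_gt0] : (gp < 0) || (0 < gp) by rewrite -neq_lt.
  have [gv_ge0|gv_lt0] := leP 0 gv; last by apply: weaken; apply: reject => //; left.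
  pose a : R := `|gv + gp|; have a0 : 0 <= a by exact: normr_ge0.
  have aM : 0 <= a * M by rewrite mulr_ge0 // ltW.
  apply: (@target_performance p q d (1 + a * M) 1 1 a ((3 + a * M + 2 * a) / - gp)) => //.
  - by lra.
  - by right; split => //; lra.
  move=> x x0; rewrite /target !mul1r.
  have /andP[r1 r1'] := r01 (q + d) x; have /andP[r2 r2'] := r01 (p + 2 * d) x.
  have sx : (gv + gp) * x <= a * x by rewrite ler_wpM2r // ler_norm.
  have sx' : - (a * x) <= (gv + gp) * x.
    by rewrite -mulNr ler_wpM2r // lerNl /a -normrN ler_norm.
  have pp : a * x - a * M <= a * ppart (x - M) <= a * x.
    rewrite -mulrBr !ler_wpM2l //.
      by have [xM|Mx] := leP x M; [rewrite ppart_eq0 ?subr_le0|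
        rewrite ppart_id ?subr_ge0 ?(ltW Mx) // gerBl ltW].
    by have [xM|Mx] := leP x M; [rewrite ppart_eq0 ?subr_le0|
      rewrite ppart_id ?subr_ge0 ?(ltW Mx)].
  have ax : 0 <= a * x by rewrite mulr_ge0.
  have aMx : 0 <= a * M * x by rewrite mulr_ge0.
  have Ngp : 0 < - gp by rewrite oppr_gt0.
  rewrite -[X in X / gp]opprK mulNr -mulrN -invrN.
  rewrite divr_gt0 //=; last first.
    by move: r1 r2 sx pp; lra.
  rewrite mulrAC ler_pM2r ?invr_gt0 //.
  have -> : (3 + a * M + 2 * a) * (1 + x) =
      3 + a * M + 2 * a + 3 * x + a * M * x + 2 * (a * x) by ring.
  have /andP[_ pp'] := pp; move: r1' r2' sx' pp' ax aMx.
  move: (a * ppart _) (a * M * x) (a * x) (a * M) ((gv + gp) * x) (ramp _ _ _) (ramp _ _ _).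
  by clearbody a; move=> u1 u2 u3 u4 u5 u6 u7; lra.
have [s_gt0|s_le0] := ltP 0 (gv + gp); last first.
  by apply: weaken; apply: reject; [lra|right].
have p0 : 0 <= p by exact: le_trans qp.
pose c2 := (gv + gp) * (p + 2 * d) / 2.
have c2_gt0 : 0 < c2 by rewrite divr_gt0 // mulr_gt0 //; lra.
apply: (@target_performance p q d (-1) 1 c2 0 ((gv + gp + 1) / gp)) => //.
  by left; split; lra.
move=> x x0; rewrite /target mul0r addr0 mul1r.
have sx0 : 0 <= (gv + gp) * x by rewrite mulr_ge0 // ltW.
have /andP[r1 r1'] := r01 (q + d) x; have /andP[r2 r2'] := r01 (p + 2 * d) x.
have cr2 : 0 <= c2 * ramp (p + 2 * d) d x by rewrite mulr_ge0 // ltW.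
have lt_sx : -1 + ramp (q + d) d x + c2 * ramp (p + 2 * d) d x < (gv + gp) * x.
  have [xp|px] := leP x (p + 2 * d).
    rewrite [ramp (p + 2 * d) d x]ramp_le // mulr0 addr0.
    have [xq|qx] := leP x (q + d); first by rewrite ramp_le //; lra.
    have : 0 < (gv + gp) * x by rewrite mulr_gt0 //; lra.
    by lra.
  have : (gv + gp) * (p + 2 * d) < (gv + gp) * x by rewrite ltr_pM2l.
  have : c2 * ramp (p + 2 * d) d x <= c2 by rewrite ler_piMr // ltW.
  have : c2 * 2 = (gv + gp) * (p + 2 * d) by rewrite divfK.
  by move: c2_gt0 r1'; lra.
rewrite divr_gt0 ?subr_gt0 //= [leRHS]mulrAC ler_pM2r ?invr_gt0 //.
have -> : (gv + gp + 1) * (1 + x) = (gv + gp) + 1 + (gv + gp) * x + x by ring.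
by move: r1 cr2 s_gt0 x0; lra.
Qed.

End Achievability.

Unset Implicit Arguments.

Theorem theorem4p3 (R : realType) (n k : nat) (gv gp : R) (v : 'I_n -> R) :
  (1 <= n)%N -> (1 <= k)%N -> gp != 0 -> (forall i, 0 <= v i) ->
  benchmark gv gp k v =
  ereal_sup [set (performance gv gp (two_level_lottery k pq.1 pq.2) v)%:E
            | pq in [set pq : \bar R * \bar R | (0 <= pq.2 <= pq.1)%E]].
Proof.
move=> _ _ gp0 v0; apply/le_anti/andP; split.
  apply: ge_ereal_sup => _ [f [densf ironf] <-].
  apply: (highest_score_le_sup gp0 v0) => [p q qp|a b _].
    by apply: ereal_sup_ubound; exists (p, q).
  exact: ironed_virtual_value_le.
apply: ge_ereal_sup => _ [[p q] /= qp <-].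
have [p' [q' [[q'0 q'p'] ->]]] := finite_thresholds gv gp k v0 qp.
exact: lottery_le_benchmark.
Qed.
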